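(* Let $A$ be a nonzero tensor, either in $\otimes_{j=1}^d\mathbb{R}^{n_j}$ or in $\mathrm{Sym}^d(\mathbb{R}^n)$. Then $A$ is critical (in the respective space) if and only if \[ \|A\|_2\,\|A\|_*=\|A\|_F^2. \]
   Context: Tensors and norms: \begin{itemize} \item The Frobenius inner product is $\langle A,A'\rangle_F=\sum a_{i_1\dots i_d}a'_{i_1\dots i_d}$, with norm $\|\cdot\|_F$. \item The spectral norm is $\|A\|_2=\max_{\|x^{(j)}\|=1}\langle A,x^{(1)}\otimes\cdots\otimes x^{(d)}\rangle_F$. \item The nuclear norm is $\|A\|_*=\inf\{\sum_{\ell=1}^r\|Y_\ell\|_F: A=\sum_{\ell=1}^rY_\ell,\ r\in\mathbb{N},\ Y_\ell\text{ rank one}\}$. \end{itemize} Generalized gradient (Clarke): for a Lipschitz function $f$ on a Euclidean space, $\partial f(p)$ is the convex hull of all limits of $\nabla f(p_i)$, taken over sequences $p_i\to p$ of differentiability points. Criticality: \begin{itemize} \item A nonzero $A\in\otimes_{j=1}^d\mathbb{R}^{n_j}$ is critical if $\lambda A\in\partial\|\cdot\|_2\,(A/\|A\|_F)$ for some $\lambda\in\mathbb{R}$, with the spectral norm regarded as a function on $\otimes_{j=1}^d\mathbb{R}^{n_j}$. \item A nonzero $A\in\mathrm{Sym}^d(\mathbb{R}^n)$ is critical (in $\mathrm{Sym}^d(\mathbb{R}^n)$) if the same holds with the spectral norm regarded as a function on the Euclidean space $(\mathrm{Sym}^d(\mathbb{R}^n),\langle\cdot,\cdot\rangle_F)$. \end{itemize}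 *)

(* Defs.v *)
From Stdlib Require Import Reals Lra List Permutation ClassicalEpsilon.
Import ListNotations.
Open Scope R_scope.

(* A tensor with format ns = [n_1; ...; n_d] is a function on multi-indices
   (lists of naturals); only its values on the valid multi-indices
   [indices ns] matter (all notions below only read those values). *)
Definition tensor := list nat -> R.

Fixpoint indices (ns : list nat) : list (list nat) :=
  match ns with
  | [] => [[]]
  | n :: ns' => flat_map (fun k => map (cons k) (indices ns')) (seq 0 n)
  end.

Definition lsum {A : Type} (f : A -> R) (l : list A) : R :=
  fold_right (fun a s => f a + s) 0 l.

Definition frob (ns : list nat) (A B : tensor) : R :=
  lsum (fun i => A i * B i) (indices ns).
Definition normF (ns : list nat) (A : tensor) : R := sqrt (frob ns A A).

Definition tadd (A B : tensor) : tensor := fun i => A i + B i.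
Definition tsub (A B : tensor) : tensor := fun i => A i - B i.
Definition tscale (c : R) (A : tensor) : tensor := fun i => c * A i.

Definition tnonzero (ns : list nat) (A : tensor) : Prop :=
  exists i, In i (indices ns) /\ A i <> 0.

(* vectors x in R^n are functions nat -> R, read on 0..n-1 *)
Definition unit_vec (n : nat) (x : nat -> R) : Prop :=
  lsum (fun k => x k ^ 2) (seq 0 n) = 1.

Fixpoint outer (xs : list (nat -> R)) (i : list nat) : R :=
  match xs, i with
  | x :: xs', k :: i' => x k * outer xs' i'
  | _, _ => 1
  end.

Definition Rmax_set (E : R -> Prop) : R :=
  epsilon (inhabits 0) (fun m => E m /\ forall y, E y -> y <= m).
Definition Rinf_set (E : R -> Prop) : R :=
  epsilon (inhabits 0)
    (fun m => (forall y, E y -> m <= y) /\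
              (forall b, (forall y, E y -> b <= y) -> b <= m)).

Definition specnorm (ns : list nat) (A : tensor) : R :=
  Rmax_set (fun v => exists xs : list (nat -> R),
                Forall2 unit_vec ns xs /\ v = frob ns A (outer xs)).

Definition rank_one (ns : list nat) (Y : tensor) : Prop :=
  (exists xs : list (nat -> R), length xs = length ns /\
       forall i, In i (indices ns) -> Y i = outer xs i)
  /\ tnonzero ns Y.

Definition nucnorm (ns : list nat) (A : tensor) : R :=
  Rinf_set (fun v => exists Ys : list tensor,
      Ys <> [] /\ Forall (rank_one ns) Ys /\
      (forall i, In i (indices ns) -> A i = lsum (fun Y => Y i) Ys) /\
      v = lsum (normF ns) Ys).

(* Euclidean (sub)spaces: a predicate V on tensors (a linear subspace) *)
Definition full_space : tensor -> Prop := fun _ => True.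
Definition sym_space (ns : list nat) (A : tensor) : Prop :=
  forall i i', In i (indices ns) -> Permutation i i' -> A i = A i'.

Definition has_grad (ns : list nat) (V : tensor -> Prop)
    (f : tensor -> R) (p g : tensor) : Prop :=
  V g /\
  forall eps, 0 < eps -> exists delta, 0 < delta /\
    forall h, V h -> 0 < normF ns h < delta ->
      Rabs (f (tadd p h) - f p - frob ns g h) <= eps * normF ns h.

Definition limit_grad (ns : list nat) (V : tensor -> Prop)
    (f : tensor -> R) (p g : tensor) : Prop :=
  V g /\
  exists (ps gs : nat -> tensor),
    (forall k, V (ps k)) /\
    (forall k, has_grad ns V f (ps k) (gs k)) /\
    Un_cv (fun k => normF ns (tsub (ps k) p)) 0 /\
    Un_cv (fun k => normF ns (tsub (gs k) g)) 0.

Definition clarke (ns : list nat) (V : tensor -> Prop)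
    (f : tensor -> R) (p q : tensor) : Prop :=
  V q /\
  exists cgs : list (R * tensor),
    cgs <> [] /\
    Forall (fun cg => 0 <= fst cg /\ limit_grad ns V f p (snd cg)) cgs /\
    lsum fst cgs = 1 /\
    forall i, In i (indices ns) -> q i = lsum (fun cg => fst cg * snd cg i) cgs.

Definition critical (ns : list nat) (V : tensor -> Prop) (A : tensor) : Prop :=
  tnonzero ns A /\
  exists lam : R,
    clarke ns V (specnorm ns) (tscale (/ normF ns A) A) (tscale lam A).

(* Main.v *)
(* The spectral norm f is the support function of the compact set U of unit rank-one tensors.
   A gradient of f restricted to a subspace V, and hence a limit of gradients at p, is the
   orthogonal projection P u of some u in U maximising <p, .>; the maximum is <p, u> = f p.
   If lam A is a convex combination of such P u, pairing with p = A / |A|_F gives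
   lam = f A / |A|_F^2. Each P u is a convex combination of elements of U (for symmetric
   tensors, the average of the permuted products), so the nuclear norm of A is at most 1 / lam,
   while |A|_F^2 <= |A|_* f A always holds.

   Conversely, if equality holds, then q = lam A satisfies <q, h> <= f h for all h and
   <q, p> = f p. For every direction h in V, let u maximise <p + t h, v> + s |P v|^2 over
   v in U. At p + t h + 2 s P u the maximum over U grows quadratically away from u, so f is
   differentiable on V there with gradient P u; letting t -> 0 with s = t^2 yields a limit of
   gradients g at p with <q, h> <= <g, h>. As the set of limits of gradients is compact, q is
   in its convex hull. No appeal to Banach's theorem on symmetric tensors is needed. *)
Require Import Defs.
From Stdlib Require Import Reals Lra Lia List Factorial Permutation Classical ClassicalEpsilon.
Import ListNotations.
Open Scope R_scope.

(** * Finite sums, sequences and maxima *)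

Lemma lsum_cons {A : Type} (f : A -> R) a l : lsum f (a :: l) = f a + lsum f l.
Proof. reflexivity. Qed.

Lemma lsum_nil {A : Type} (f : A -> R) : lsum f [] = 0.
Proof. reflexivity. Qed.

Lemma lsum_ext {A : Type} (f g : A -> R) l :
  (forall a, In a l -> f a = g a) -> lsum f l = lsum g l.
Proof.
  induction l as [|a l IH]; intros H; [reflexivity|].
  rewrite !lsum_cons, (H a (in_eq _ _)), IH; auto using in_cons.
Qed.

Lemma lsum_plus {A : Type} (f g : A -> R) l :
  lsum (fun a => f a + g a) l = lsum f l + lsum g l.
Proof. induction l; rewrite ?lsum_nil, ?lsum_cons; lra. Qed.

Lemma lsum_scale {A : Type} c (f : A -> R) l :
  lsum (fun a => c * f a) l = c * lsum f l.
Proof. induction l; rewrite ?lsum_nil, ?lsum_cons; [lra|]. rewrite IHl; ring. Qed.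

Lemma lsum_zero {A : Type} (l : list A) : lsum (fun _ => 0) l = 0.
Proof. induction l; rewrite ?lsum_nil, ?lsum_cons; lra. Qed.

Lemma lsum_app {A : Type} (f : A -> R) l l' : lsum f (l ++ l') = lsum f l + lsum f l'.
Proof. induction l; cbn [app]; rewrite ?lsum_nil, ?lsum_cons; lra. Qed.

Lemma lsum_map {A B : Type} (g : B -> A) (f : A -> R) l :
  lsum f (map g l) = lsum (fun b => f (g b)) l.
Proof. induction l; cbn [map]; rewrite ?lsum_nil, ?lsum_cons; congruence. Qed.

Lemma lsum_flat_map {A B : Type} (g : B -> list A) (f : A -> R) l :
  lsum f (flat_map g l) = lsum (fun b => lsum f (g b)) l.
Proof.
  induction l; cbn [flat_map]; [reflexivity|].
  rewrite lsum_app, lsum_cons; congruence.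
Qed.

Lemma lsum_perm {A : Type} (f : A -> R) l l' : Permutation l l' -> lsum f l = lsum f l'.
Proof. induction 1; rewrite ?lsum_cons; lra. Qed.

Lemma lsum_swap {A B : Type} (f : A -> B -> R) l l' :
  lsum (fun a => lsum (f a) l') l = lsum (fun b => lsum (fun a => f a b) l) l'.
Proof.
  induction l as [|a l IH].
  - symmetry; apply lsum_zero.
  - rewrite lsum_cons, IH, <- lsum_plus. reflexivity.
Qed.

Lemma lsum_nonneg {A : Type} (f : A -> R) l :
  (forall a, In a l -> 0 <= f a) -> 0 <= lsum f l.
Proof.
  induction l as [|a l IH]; intros H; [rewrite lsum_nil; lra|].
  rewrite lsum_cons. pose proof (H a (in_eq _ _)).
  assert (0 <= lsum f l) by auto using in_cons. lra.
Qed.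

Lemma lsum_le {A : Type} (f g : A -> R) l :
  (forall a, In a l -> f a <= g a) -> lsum f l <= lsum g l.
Proof.
  induction l as [|a l IH]; intros H; [rewrite !lsum_nil; lra|].
  rewrite !lsum_cons. pose proof (H a (in_eq _ _)).
  assert (lsum f l <= lsum g l) by auto using in_cons. lra.
Qed.

Lemma lsum_ge_term {A : Type} (f : A -> R) l a :
  (forall b, In b l -> 0 <= f b) -> In a l -> f a <= lsum f l.
Proof.
  intros H Ha. destruct (in_split _ _ Ha) as (l1 & l2 & ->).
  assert (0 <= lsum f l1) by (apply lsum_nonneg; auto using in_or_app).
  assert (0 <= lsum f l2) by (apply lsum_nonneg; auto using in_or_app, in_cons).
  rewrite lsum_app, lsum_cons. lra.
Qed.

(** * Limits along subsequences and attained maxima *)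

Lemma cv_const c : Un_cv (fun _ => c) c.
Proof. intros e He. exists 0%nat. intros. rewrite Rdist_eq. exact He. Qed.

Lemma cv_ext u v l : (forall n, u n = v n) -> Un_cv u l -> Un_cv v l.
Proof.
  intros E H e He. destruct (H e He) as [N HN]. exists N. intros n Hn.
  rewrite <- E. auto.
Qed.

(** Here and below a subsequence is given by a map [phi] with [n <= phi n]; this preserves limits
    and is closed under composition. *)
Lemma cv_sub (u : nat -> R) phi l :
  (forall n : nat, (n <= phi n)%nat) -> Un_cv u l -> Un_cv (fun n => u (phi n)) l.
Proof.
  intros Hp H e He. destruct (H e He) as [N HN]. exists N. intros n Hn.
  apply HN. specialize (Hp n). lia.
Qed.

Lemma cv_lsum {A : Type} (f : nat -> A -> R) (g : A -> R) l :
  (forall a, In a l -> Un_cv (fun n => f n a) (g a)) ->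
  Un_cv (fun n => lsum (f n) l) (lsum g l).
Proof.
  induction l as [|a l IH]; intros H.
  - exact (cv_const 0).
  - apply (CV_plus (fun n => f n a) (fun n => lsum (f n) l)); auto using in_eq, in_cons.
Qed.

Lemma cv_squeeze0 u v : (forall n, 0 <= u n <= v n) -> Un_cv v 0 -> Un_cv u 0.
Proof.
  intros H Hv e He. destruct (Hv e He) as [N HN]. exists N. intros n Hn.
  specialize (HN n Hn). specialize (H n). unfold Rdist in *.
  rewrite Rminus_0_r in *. rewrite Rabs_pos_eq by lra.
  rewrite Rabs_pos_eq in HN by lra. lra.
Qed.

Lemma cv_inv_S : Un_cv (fun n => / (INR n + 1)) 0.
Proof.
  intros e He. destruct (archimed (/ e)) as [Ha _].
  assert (Hz : (0 <= up (/ e))%Z).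
  { apply le_IZR. pose proof (Rinv_0_lt_compat e He). lra. }
  exists (Z.to_nat (up (/ e))). intros n Hn.
  assert (IZR (up (/ e)) <= INR n).
  { rewrite INR_IZR_INZ. apply IZR_le. lia. }
  unfold Rdist. rewrite Rminus_0_r.
  pose proof (Rinv_0_lt_compat e He).
  rewrite Rabs_pos_eq.
  - rewrite <- (Rinv_inv e). apply Rinv_lt_contravar; nra.
  - left. apply Rinv_0_lt_compat. lra.
Qed.

Lemma inv_S_pos n : 0 < / (INR n + 1).
Proof. apply Rinv_0_lt_compat. pose proof (pos_INR n). lra. Qed.

Lemma bounded_subsequence (u : nat -> R) M :
  (forall n, Rabs (u n) <= M) ->
  exists phi l, (forall n : nat, (n <= phi n)%nat) /\ Un_cv (fun n => u (phi n)) l.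
Proof.
  intros HM.
  destruct (Bolzano_Weierstrass u _ (compact_P3 (- M) M)) as [l Hl].
  { intros n. specialize (HM n). unfold Rabs in HM. destruct Rcase_abs in HM; lra. }
  (* [l] is a cluster value, so beyond every index [n] some term lies within [/ (INR n + 1)] of
     it. *)
  destruct (choice (fun n p => (n <= p)%nat /\ Rabs (u p - l) < / (INR n + 1))) as [phi Hphi].
  { intros n.
    destruct (Hl (disc l (mkposreal _ (inv_S_pos n))) n) as (p & Hp & Hd).
    - exists (mkposreal _ (inv_S_pos n)). intros x Hx; exact Hx.
    - exists p. split; [exact Hp|exact Hd]. }
  exists phi, l. split; [intros n; apply Hphi|].
  intros e He. destruct (cv_inv_S e He) as [N HN]. exists N. intros n Hn.
  specialize (HN n Hn). destruct (Hphi n) as [_ H].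
  unfold Rdist in *. rewrite Rminus_0_r, Rabs_pos_eq in HN by (left; apply inv_S_pos). lra.
Qed.

(** Compactness of [D] and continuity of [F] enter as one hypothesis: along a subsequence, [F]
    converges to its value at a point of [D]. It excludes points with [F (s k)] above [INR k] for
    all [k], so a supremum exists, and applied to a maximising sequence it shows that the supremum
    is attained. *)
Lemma extreme_value {T : Type} (D : T -> Prop) (F : T -> R) :
  (exists x, D x) ->
  (forall s : nat -> T, (forall k, D (s k)) ->
     exists phi x, D x /\ (forall n : nat, (n <= phi n)%nat) /\
       Un_cv (fun k => F (s (phi k))) (F x)) ->
  exists x, D x /\ forall y, D y -> F y <= F x.
Proof.
  intros [x0 Hx0] Hc.
  assert (Hb : bound (fun v => exists x, D x /\ v = F x)).
  { apply NNPP; intros Hn.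
    destruct (choice (fun (k : nat) x => D x /\ INR k < F x)) as [s Hs].
    { intros k. apply NNPP; intros Hk. apply Hn. exists (INR k).
      intros v (x & Hx & ->). apply Rnot_lt_le; intros Hlt. apply Hk. eauto. }
    destruct (Hc s (fun k => proj1 (Hs k))) as (phi & x & _ & Hphi & Hcv).
    destruct (Hcv 1 Rlt_0_1) as [N HN].
    destruct (archimed (Rabs (F x) + 1)) as [Ha _].
    set (m := (N + Z.to_nat (up (Rabs (F x) + 1)))%nat).
    assert (Hm : IZR (up (Rabs (F x) + 1)) <= INR (phi m)).
    { rewrite INR_IZR_INZ. apply IZR_le. specialize (Hphi m). unfold m in Hphi at 1. lia. }
    specialize (HN m ltac:(unfold m; lia)). destruct (Hs (phi m)) as [_ Hlt].
    apply Rabs_def2 in HN. pose proof (Rle_abs (F x)). lra. }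
  destruct (completeness _ Hb) as [S [HS1 HS2]]; [eauto|].
  destruct (choice (fun (k : nat) x => D x /\ S - / (INR k + 1) < F x)) as [s Hs].
  { intros k. apply NNPP; intros Hk. pose proof (inv_S_pos k).
    enough (S <= S - / (INR k + 1)) by lra.
    apply HS2. intros v (x & Hx & ->). apply Rnot_lt_le; intros Hlt. apply Hk. eauto. }
  destruct (Hc s (fun k => proj1 (Hs k))) as (phi & x & Hx & Hphi & Hcv).
  exists x. split; [exact Hx|]. intros y Hy.
  apply Rle_trans with S; [apply HS1; eauto|].
  refine (@Rle_cv_lim (fun k => S - / (INR (phi k) + 1)) (fun k => F (s (phi k))) _ _ _ _ Hcv).
  - intros k. left. apply Hs.
  - rewrite <- (Rminus_0_r S) at 1. apply CV_minus; [apply cv_const|].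
    exact (cv_sub (fun k => / (INR k + 1)) phi 0 Hphi cv_inv_S).
Qed.

(** * Frobenius geometry and unit rank-one tensors *)

Lemma frob_sym ns A B : frob ns A B = frob ns B A.
Proof. apply lsum_ext; intros; ring. Qed.

Lemma frob_ext ns A A' B B' :
  (forall i, In i (indices ns) -> A i = A' i) ->
  (forall i, In i (indices ns) -> B i = B' i) -> frob ns A B = frob ns A' B'.
Proof. intros H H'. apply lsum_ext; intros. rewrite H, H'; auto. Qed.

Lemma frob_add_l ns A B C : frob ns (tadd A B) C = frob ns A C + frob ns B C.
Proof.
  unfold frob. rewrite <- lsum_plus. apply lsum_ext; intros; unfold tadd; ring.
Qed.

Lemma frob_scale_l ns c A B : frob ns (tscale c A) B = c * frob ns A B.
Proof.
  unfold frob. rewrite <- lsum_scale. apply lsum_ext; intros; unfold tscale; ring.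
Qed.

Lemma frob_sub_l ns A B C : frob ns (tsub A B) C = frob ns A C - frob ns B C.
Proof.
  replace (frob ns (tsub A B) C) with (frob ns (tadd A (tscale (-1) B)) C).
  - rewrite frob_add_l, frob_scale_l. ring.
  - apply frob_ext; intros; unfold tadd, tscale, tsub; ring.
Qed.

Lemma frob_add_r ns A B C : frob ns C (tadd A B) = frob ns C A + frob ns C B.
Proof. rewrite !(frob_sym ns C). apply frob_add_l. Qed.

Lemma frob_sub_r ns A B C : frob ns C (tsub A B) = frob ns C A - frob ns C B.
Proof. rewrite !(frob_sym ns C). apply frob_sub_l. Qed.

Lemma frob_scale_r ns c A B : frob ns B (tscale c A) = c * frob ns B A.
Proof. rewrite !(frob_sym ns B). apply frob_scale_l. Qed.

Lemma frob_lsum_l {T : Type} ns (F : T -> tensor) l B :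
  frob ns (fun i => lsum (fun x => F x i) l) B = lsum (fun x => frob ns (F x) B) l.
Proof.
  unfold frob. rewrite (lsum_swap (fun x i => F x i * B i)). apply lsum_ext; intros i _.
  rewrite Rmult_comm, <- lsum_scale. apply lsum_ext; intros; ring.
Qed.

Lemma frob_pos ns A : 0 <= frob ns A A.
Proof. apply lsum_nonneg; intros; nra. Qed.

Lemma normF_nonneg ns A : 0 <= normF ns A.
Proof. apply sqrt_pos. Qed.

Lemma normF_sq ns A : normF ns A * normF ns A = frob ns A A.
Proof. apply sqrt_sqrt, frob_pos. Qed.

Lemma normF_ext ns A B :
  (forall i, In i (indices ns) -> A i = B i) -> normF ns A = normF ns B.
Proof. intros H. unfold normF. f_equal. apply frob_ext; assumption. Qed.

Lemma normF_scale ns c A : normF ns (tscale c A) = Rabs c * normF ns A.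
Proof.
  unfold normF. rewrite frob_scale_l, frob_scale_r, <- Rmult_assoc, sqrt_mult.
  - f_equal. apply sqrt_Rsqr_abs.
  - nra.
  - apply frob_pos.
Qed.

Lemma coord_le_normF ns A i : In i (indices ns) -> Rabs (A i) <= normF ns A.
Proof.
  intros Hi. rewrite <- sqrt_Rsqr_abs. apply sqrt_le_1_alt.
  apply (lsum_ge_term (fun i => A i * A i)); [intros; nra | exact Hi].
Qed.

Lemma normF_zero ns A i : normF ns A = 0 -> In i (indices ns) -> A i = 0.
Proof.
  intros H Hi. pose proof (coord_le_normF ns A i Hi). rewrite H in *.
  unfold Rabs in *. destruct Rcase_abs; lra.
Qed.

Lemma normF_pos ns A : tnonzero ns A -> 0 < normF ns A.
Proof.
  intros (i & Hi & HA). destruct (normF_nonneg ns A) as [|E]; [assumption|].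
  symmetry in E. exfalso. apply HA. eauto using normF_zero.
Qed.

Lemma frob_zero_l ns A B : normF ns A = 0 -> frob ns A B = 0.
Proof.
  intros H. unfold frob. rewrite <- (lsum_zero (indices ns)). apply lsum_ext; intros i Hi.
  rewrite (normF_zero ns A i H Hi). ring.
Qed.

(** The squared norm of |B| A - |A| B equals 2 |A| |B| (|A| |B| - <A, B>); a vanishing norm is
    treated apart because the factor |A| |B| cannot then be cancelled. *)
Lemma cauchy_schwarz ns A B : frob ns A B <= normF ns A * normF ns B.
Proof.
  pose proof (frob_pos ns (tsub (tscale (normF ns B) A) (tscale (normF ns A) B))) as H.
  rewrite !frob_sub_l, !frob_sub_r, !frob_scale_l, !frob_scale_r in H.
  rewrite <- !normF_sq, (frob_sym ns B A) in H.
  pose proof (normF_nonneg ns A) as Ha. pose proof (normF_nonneg ns B) as Hb.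
  destruct Ha as [Ha|Ha].
  - destruct Hb as [Hb|Hb].
    + assert (0 < normF ns A * normF ns B) by nra. nra.
    + rewrite frob_sym, frob_zero_l; [rewrite <- Hb; lra | auto].
  - rewrite frob_zero_l; [rewrite <- Ha; lra | auto].
Qed.

Lemma cv_frob ns (a b : nat -> tensor) A B :
  (forall i, In i (indices ns) -> Un_cv (fun n => a n i) (A i)) ->
  (forall i, In i (indices ns) -> Un_cv (fun n => b n i) (B i)) ->
  Un_cv (fun n => frob ns (a n) (b n)) (frob ns A B).
Proof.
  intros Ha Hb. apply (cv_lsum (fun n i => a n i * b n i) (fun i => A i * B i)).
  intros i Hi. apply (CV_mult (fun n => a n i) (fun n => b n i)); auto.
Qed.

Lemma cv_coord ns (a : nat -> tensor) A i :
  Un_cv (fun n => normF ns (tsub (a n) A)) 0 -> In i (indices ns) ->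
  Un_cv (fun n => a n i) (A i).
Proof.
  intros H Hi e He. destruct (H e He) as [N HN]. exists N. intros n Hn.
  specialize (HN n Hn). unfold Rdist in *. rewrite Rminus_0_r in HN.
  rewrite Rabs_pos_eq in HN by apply normF_nonneg.
  pose proof (coord_le_normF ns (tsub (a n) A) i Hi). unfold tsub in *. lra.
Qed.

Lemma cv_normF ns (a : nat -> tensor) A :
  (forall i, In i (indices ns) -> Un_cv (fun n => a n i) (A i)) ->
  Un_cv (fun n => normF ns (tsub (a n) A)) 0.
Proof.
  intros H. rewrite <- sqrt_0. unfold normF.
  apply (continuity_seq sqrt (fun n => frob ns (tsub (a n) A) (tsub (a n) A))).
  - apply continuity_pt_sqrt. lra.
  - replace 0 with (frob ns (fun _ => 0) (fun _ => 0)).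
    + assert (forall i, In i (indices ns) -> Un_cv (fun n => tsub (a n) A i) 0).
      { intros i Hi. rewrite <- (Rminus_diag (A i)).
        apply CV_minus; [auto|apply cv_const]. }
      apply cv_frob; assumption.
    + transitivity (lsum (fun _ => 0) (indices ns)); [|apply lsum_zero].
      apply lsum_ext; intros; ring.
Qed.

(** * Multi-indices and products of unit vectors *)

Lemma lsum_indices_cons (F : list nat -> R) n ns :
  lsum F (indices (n :: ns)) =
  lsum (fun k => lsum (fun i => F (k :: i)) (indices ns)) (seq 0 n).
Proof.
  cbn [indices]. rewrite lsum_flat_map. apply lsum_ext; intros. apply lsum_map.
Qed.

Lemma in_indices_cons n ns i :
  In i (indices (n :: ns)) <->
  exists k j, i = k :: j /\ (k < n)%nat /\ In j (indices ns).
Proof.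
  cbn [indices]. rewrite in_flat_map. split.
  - intros (k & Hk & Hi). apply in_map_iff in Hi as (j & <- & Hj).
    apply in_seq in Hk. exists k, j. repeat split; [lia|exact Hj].
  - intros (k & j & -> & Hk & Hj). exists k. split; [apply in_seq; lia|].
    apply in_map, Hj.
Qed.

(** The set over which the spectral norm maximises. Membership fixes the function itself, whereas
    tensors are otherwise compared on [indices ns] only. *)
Definition unit_product (ns : list nat) (u : tensor) : Prop :=
  exists xs, Forall2 unit_vec ns xs /\ u = outer xs.

Lemma frob_outer_cons n ns x xs :
  frob (n :: ns) (outer (x :: xs)) (outer (x :: xs)) =
  lsum (fun k => x k ^ 2) (seq 0 n) * frob ns (outer xs) (outer xs).
Proof.
  unfold frob. rewrite lsum_indices_cons, Rmult_comm, <- lsum_scale.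
  apply lsum_ext; intros k _. rewrite Rmult_comm, <- lsum_scale.
  apply lsum_ext; intros i _. cbn [outer]. ring.
Qed.

Lemma unit_product_norm ns u : unit_product ns u -> frob ns u u = 1.
Proof.
  intros (xs & H & ->). induction H as [|n x ns xs Hx _ IH].
  - unfold frob, indices. rewrite lsum_cons, lsum_nil. cbn. ring.
  - rewrite frob_outer_cons, IH, Hx. ring.
Qed.

Lemma unit_product_normF ns u : unit_product ns u -> normF ns u = 1.
Proof.
  intros H. unfold normF. rewrite (unit_product_norm ns u H). apply sqrt_1.
Qed.

(** Successive extraction over the list [l]. The notion of convergence [cv] is abstract so that the
    lemma serves for real numbers and for tensors; [d] is the value of the limit family off [l]. *)
Lemma simultaneous_subsequence {X : Type} (d : X) (G Q : X -> Prop)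
    (cv : (nat -> X) -> X -> Prop) (l : list nat) (s : nat -> nat -> X) :
  (forall u phi x, (forall n : nat, (n <= phi n)%nat) -> cv u x -> cv (fun n => u (phi n)) x) ->
  (forall u, (forall k : nat, G (u k)) ->
     exists phi x, Q x /\ (forall n : nat, (n <= phi n)%nat) /\ cv (fun n => u (phi n)) x) ->
  (forall k j, In j l -> G (s k j)) ->
  exists phi x, (forall n : nat, (n <= phi n)%nat) /\
    forall j, In j l -> Q (x j) /\ cv (fun k => s (phi k) j) (x j).
Proof.
  intros Hsub Hc. induction l as [|j0 l IH]; intros HG.
  - exists (fun n => n), (fun _ => d). split; [auto|]. intros j [].
  - destruct IH as (phi & x & Hphi & Hx). { intros; apply HG, in_cons; assumption. }
    destruct (Hc (fun n => s (phi n) j0)) as (psi & c & HQ & Hpsi & Hcv).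
    { intros; apply HG, in_eq. }
    exists (fun n => phi (psi n)), (fun j => if Nat.eq_dec j j0 then c else x j). split.
    + intros n. specialize (Hpsi n). specialize (Hphi (psi n)). lia.
    + intros j Hj. destruct Nat.eq_dec as [->|Hne]; [auto|].
      destruct Hj as [->|Hj]; [contradiction|]. split; [apply Hx, Hj|].
      apply (Hsub (fun n => s (phi n) j) psi); [auto|]. apply Hx, Hj.
Qed.

Lemma bounded_subsequence_list (l : list nat) (s : nat -> nat -> R) M :
  (forall k j, In j l -> Rabs (s k j) <= M) ->
  exists phi x, (forall n : nat, (n <= phi n)%nat) /\
    forall j, In j l -> Un_cv (fun k => s (phi k) j) (x j).
Proof.
  intros H.
  destruct (simultaneous_subsequence 0 (fun c => Rabs c <= M) (fun _ => True) Un_cv l s)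
    as (phi & x & Hphi & Hx); [exact cv_sub| |exact H|].
  - intros u Hu. destruct (bounded_subsequence u M Hu) as (phi & c & Hphi & Hc). eauto.
  - exists phi, x. split; [exact Hphi|]. apply Hx.
Qed.

Lemma unit_vec_subsequence n (s : nat -> nat -> R) :
  (forall k, unit_vec n (s k)) ->
  exists phi x, (forall n : nat, (n <= phi n)%nat) /\ unit_vec n x /\
    forall j, (j < n)%nat -> Un_cv (fun k => s (phi k) j) (x j).
Proof.
  intros Hs. destruct (bounded_subsequence_list (seq 0 n) s 1) as (phi & x & Hphi & Hx).
  - intros k j Hj. pose proof (lsum_ge_term (fun j => s k j ^ 2) (seq 0 n) j
      ltac:(intros; apply pow2_ge_0) Hj) as H. rewrite (Hs k) in H.
    apply Rabs_le. cbn beta in H. nra.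
  - exists phi, x. split; [exact Hphi|]. split.
    + refine (UL_sequence (fun k => lsum (fun j => s (phi k) j ^ 2) (seq 0 n)) _ _ _ _).
      * apply (cv_lsum (fun k j => s (phi k) j ^ 2) (fun j => x j ^ 2)). intros j Hj.
        specialize (Hx j Hj).
        apply (cv_ext (fun k => s (phi k) j * s (phi k) j)); [intros; ring|].
        replace (x j ^ 2) with (x j * x j) by ring. apply CV_mult; exact Hx.
      * apply (cv_ext (fun _ => 1)); [|apply cv_const]. intros k; symmetry; apply Hs.
    + intros j Hj. apply Hx, in_seq. lia.
Qed.

(** A product of finitely many unit spheres is compact and [outer] is continuous in its factors. The
    factors are extracted one at a time, along the format. *)
Lemma unit_product_compact ns (s : nat -> tensor) :
  (forall k, unit_product ns (s k)) ->
  exists phi u, unit_product ns u /\ (forall n : nat, (n <= phi n)%nat) /\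
    forall i, In i (indices ns) -> Un_cv (fun k => s (phi k) i) (u i).
Proof.
  intros Hs. destruct (choice _ Hs) as [xss Hxss]. clear Hs.
  enough (exists phi xs, Forall2 unit_vec ns xs /\ (forall n : nat, (n <= phi n)%nat) /\
    forall i, In i (indices ns) -> Un_cv (fun k => outer (xss (phi k)) i) (outer xs i))
    as (phi & xs & H1 & H2 & H3).
  { exists phi, (outer xs). split; [exists xs; auto|]. split; [exact H2|]. intros i Hi.
    apply (cv_ext (fun k => outer (xss (phi k)) i)); [|auto].
    intros k. destruct (Hxss (phi k)) as [_ ->]. reflexivity. }
  assert (H : forall k, Forall2 unit_vec ns (xss k)) by (intros; apply Hxss). clear Hxss s.
  revert xss H. induction ns as [|n ns IH]; intros xss H.
  - exists (fun n => n), []. split; [constructor|]. split; [auto|].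
    intros i [<-|[]]. apply (cv_ext (fun _ => 1)); [|apply cv_const].
    intros k. specialize (H k). inversion H. reflexivity.
  - destruct (choice (fun k xxs => xss k = fst xxs :: snd xxs /\ unit_vec n (fst xxs) /\
      Forall2 unit_vec ns (snd xxs))) as [ps Hps].
    { intros k. specialize (H k). inversion H; subst. exists (y, l'). auto. }
    destruct (unit_vec_subsequence n (fun k => fst (ps k))) as (phi & x & Hphi & Hx & Hxcv).
    { intros; apply Hps. }
    destruct (IH (fun k => snd (ps (phi k)))) as (psi & xs & Hxs & Hpsi & Hxscv).
    { intros; apply Hps. }
    exists (fun k => phi (psi k)), (x :: xs). split; [auto|]. split.
    { intros m. specialize (Hpsi m). specialize (Hphi (psi m)). lia. }
    intros i Hi. apply in_indices_cons in Hi as (j & i' & -> & Hj & Hi').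
    apply (cv_ext (fun k => fst (ps (phi (psi k))) j * outer (snd (ps (phi (psi k)))) i')).
    + intros k. destruct (Hps (phi (psi k))) as [-> _]. reflexivity.
    + cbn [outer]. apply CV_mult; [|auto].
      apply (cv_sub (fun k => fst (ps (phi k)) j) psi); auto.
Qed.

Definition basis_vec (j k : nat) : R := if Nat.eq_dec j k then 1 else 0.

Lemma lsum_basis_vec j (F : nat -> R) n :
  (j < n)%nat -> lsum (fun k => basis_vec j k * F k) (seq 0 n) = F j.
Proof.
  intros Hj. assert (Hin : In j (seq 0 n)) by (apply in_seq; lia).
  destruct (in_split _ _ Hin) as (l1 & l2 & E).
  assert (Hnd : NoDup (l1 ++ j :: l2)) by (rewrite <- E; apply seq_NoDup).
  apply NoDup_remove_2 in Hnd. rewrite E, lsum_app, lsum_cons.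
  rewrite (lsum_ext _ (fun _ => 0) l1), (lsum_ext _ (fun _ => 0) l2), !lsum_zero.
  - unfold basis_vec. destruct Nat.eq_dec; [ring|congruence].
  - intros k Hk. unfold basis_vec. destruct Nat.eq_dec as [<-|]; [|ring].
    exfalso; apply Hnd, in_or_app; auto.
  - intros k Hk. unfold basis_vec. destruct Nat.eq_dec as [<-|]; [|ring].
    exfalso; apply Hnd, in_or_app; auto.
Qed.

(** Coordinates are pairings with unit products. This shows that unit products exist as soon as some
    multi-index does, and that they span. *)
Lemma basis_unit_product ns i A :
  In i (indices ns) ->
  Forall2 unit_vec ns (map basis_vec i) /\ frob ns A (outer (map basis_vec i)) = A i.
Proof.
  revert i A. induction ns as [|n ns IH]; intros i A Hi.
  - destruct Hi as [<-|[]]. split; [constructor|].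
    unfold frob, indices. rewrite lsum_cons, lsum_nil. cbn. ring.
  - apply in_indices_cons in Hi as (k & j & -> & Hk & Hj). cbn [map]. split.
    + constructor; [|apply (IH j A Hj)]. unfold unit_vec.
      rewrite <- (lsum_basis_vec k (fun _ => 1) n Hk). apply lsum_ext; intros m _.
      unfold basis_vec. destruct Nat.eq_dec; ring.
    + unfold frob. rewrite lsum_indices_cons.
      rewrite <- (proj2 (IH j (fun i => A (k :: i)) Hj)).
      rewrite <- (lsum_basis_vec k (fun k => frob ns (fun i => A (k :: i))
        (outer (map basis_vec j))) n Hk).
      apply lsum_ext; intros m _. unfold frob. rewrite <- lsum_scale.
      apply lsum_ext; intros l _. cbn [outer]. ring.
Qed.

(** Each factor is divided by its Euclidean norm, and [c] is the product of these norms. A nonzero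
    entry of the product forces every factor to be nonzero. *)
Lemma rank_one_normalize ns xs :
  length xs = length ns -> tnonzero ns (outer xs) ->
  exists c u, 0 < c /\ unit_product ns u /\
    forall i, In i (indices ns) -> outer xs i = c * u i.
Proof.
  revert xs. induction ns as [|n ns IH]; intros [|x xs] Hl Hnz; try discriminate.
  - exists 1, (outer []). split; [lra|]. split; [exists []; auto|]. intros; ring.
  - destruct Hnz as (i & Hi & Hne). apply in_indices_cons in Hi as (k & j & -> & Hk & Hj).
    cbn [outer] in Hne.
    destruct (IH xs) as (c & u & Hc & (ys & Hys & ->) & Hu).
    { now injection Hl. }
    { exists j. split; [exact Hj|]. intros E; rewrite E in Hne; lra. }
    set (S := lsum (fun k => x k ^ 2) (seq 0 n)).
    assert (HS : 0 < S).
    { pose proof (lsum_ge_term (fun k => x k ^ 2) (seq 0 n) k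
        ltac:(intros; apply pow2_ge_0) ltac:(apply in_seq; lia)) as H. cbn beta in H.
      fold S in H. assert (x k <> 0) by (intros E; rewrite E in Hne; lra).
      assert (0 < x k ^ 2) by (rewrite <- Rsqr_pow2; apply Rsqr_pos_lt; assumption). lra. }
    pose proof (sqrt_lt_R0 S HS) as Hs. pose proof (sqrt_sqrt S (Rlt_le _ _ HS)) as Hss.
    exists (sqrt S * c), (outer ((fun k => / sqrt S * x k) :: ys)). split; [nra|]. split.
    + eexists; split; [|reflexivity]. constructor; [|exact Hys]. unfold unit_vec.
      rewrite (lsum_ext _ (fun k => / S * x k ^ 2)).
      * rewrite lsum_scale. fold S. field. lra.
      * intros m _. replace (/ S) with (/ sqrt S * / sqrt S); [ring|].
        rewrite <- Rinv_mult, Hss. reflexivity.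
    + intros i Hi. apply in_indices_cons in Hi as (m & l & -> & Hm & Hl').
      cbn [outer]. rewrite (Hu l Hl'). field. lra.
Qed.

(** The sign is put into the first factor, whence the bound on the order: for order zero the
    constant 1 is the only unit product. *)
Lemma unit_product_opp ns u :
  (1 <= length ns)%nat -> unit_product ns u ->
  exists v, unit_product ns v /\ forall i, In i (indices ns) -> v i = - u i.
Proof.
  intros Hl (xs & Hxs & ->). destruct Hxs as [|n x ns xs Hx Hxs]; [cbn in Hl; lia|].
  exists (outer ((fun k => - x k) :: xs)). split.
  - eexists; split; [|reflexivity]. constructor; [|exact Hxs]. unfold unit_vec in *.
    rewrite <- Hx. apply lsum_ext; intros; ring.
  - intros i Hi. apply in_indices_cons in Hi as (m & l & -> & _ & _). cbn [outer]. ring.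
Qed.

Lemma rank_one_scale ns c u :
  (1 <= length ns)%nat -> 0 < c -> unit_product ns u -> rank_one ns (tscale c u).
Proof.
  intros Hl Hc Hu. split.
  - destruct Hu as (xs & Hxs & ->). destruct Hxs as [|n x ns xs Hx Hxs]; [cbn in Hl; lia|].
    exists ((fun k => c * x k) :: xs). split.
    + cbn. now rewrite (Forall2_length Hxs).
    + intros i Hi. apply in_indices_cons in Hi as (m & l & -> & _ & _).
      unfold tscale. cbn [outer]. ring.
  - apply NNPP; intros Hn. pose proof (unit_product_norm ns u Hu) as H.
    unfold frob in H. rewrite (lsum_ext _ (fun _ => 0)), lsum_zero in H; [lra|].
    intros i Hi. enough (u i = 0) as -> by ring.
    apply NNPP; intros Hne. apply Hn. exists i. split; [exact Hi|].
    unfold tscale. nra.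
Qed.

(** * Spectral and nuclear norms *)

(** The maximum is attained by compactness, so the [epsilon] behind [specnorm] meets its
    specification. The index [i0] guarantees that unit products exist, that is, that no dimension is
    zero. *)
Lemma specnorm_max ns A i0 :
  In i0 (indices ns) ->
  (exists u, unit_product ns u /\ specnorm ns A = frob ns A u) /\
  forall v, unit_product ns v -> frob ns A v <= specnorm ns A.
Proof.
  intros Hi0.
  destruct (extreme_value (unit_product ns) (frob ns A)) as (u & Hu & Hmax).
  - eexists. eexists. split; [|reflexivity]. apply (basis_unit_product ns i0 A Hi0).
  - intros s Hs. destruct (unit_product_compact ns s Hs) as (phi & u & Hu & Hphi & Hcv).
    exists phi, u. split; [exact Hu|]. split; [exact Hphi|].
    apply (cv_frob ns (fun _ => A) (fun k => s (phi k))); [|exact Hcv].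
    intros; apply cv_const.
  - set (E := fun v => exists xs, Forall2 unit_vec ns xs /\ v = frob ns A (outer xs)).
    assert (HE : E (specnorm ns A) /\ forall y, E y -> y <= specnorm ns A).
    { apply (epsilon_spec (inhabits 0) (fun m => E m /\ forall y, E y -> y <= m)).
      destruct Hu as (xs & Hxs & ->). exists (frob ns A (outer xs)).
      split; [exists xs; auto|]. intros y (ys & Hys & ->). apply Hmax. exists ys; auto. }
    destruct HE as [(xs & Hxs & Hv) Hle]. split.
    + exists (outer xs). split; [exists xs; auto|exact Hv].
    + intros v (ys & Hys & ->). apply Hle. exists ys; auto.
Qed.

Lemma specnorm_eq_max ns A u :
  unit_product ns u -> (forall v, unit_product ns v -> frob ns A v <= frob ns A u) ->
  forall i0, In i0 (indices ns) -> specnorm ns A = frob ns A u.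
Proof.
  intros Hu Hmax i0 Hi0. destruct (specnorm_max ns A i0 Hi0) as [(w & Hw & E) Hle].
  apply Rle_antisym; [rewrite E|]; auto.
Qed.

Lemma specnorm_scale ns c A i0 :
  In i0 (indices ns) -> 0 <= c -> specnorm ns (tscale c A) = c * specnorm ns A.
Proof.
  intros Hi0 Hc. destruct (specnorm_max ns A i0 Hi0) as [(u & Hu & E) Hle].
  rewrite E, <- frob_scale_l. apply (specnorm_eq_max _ _ _ Hu) with i0; [|exact Hi0].
  intros v Hv. rewrite !frob_scale_l, <- E. apply Rmult_le_compat_l; auto.
Qed.

Lemma specnorm_nonneg ns A i0 :
  (1 <= length ns)%nat -> In i0 (indices ns) -> 0 <= specnorm ns A.
Proof.
  intros Hl Hi0. destruct (specnorm_max ns A i0 Hi0) as [(u & Hu & _) Hle].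
  destruct (unit_product_opp ns u Hl Hu) as (v & Hv & E).
  pose proof (Hle u Hu). pose proof (Hle v Hv).
  rewrite (frob_ext ns A A v (tscale (-1) u)), frob_scale_r in H0; auto; [lra|].
  intros i Hi. unfold tscale. rewrite E by exact Hi. ring.
Qed.

(** At a nonzero coordinate, either the basis product or its negative pairs positively with [A]. *)
Lemma specnorm_pos ns A : (1 <= length ns)%nat -> tnonzero ns A -> 0 < specnorm ns A.
Proof.
  intros Hl (i & Hi & HA). destruct (specnorm_max ns A i Hi) as [_ Hle].
  destruct (basis_unit_product ns i A Hi) as [Hb E].
  assert (Hu : unit_product ns (outer (map basis_vec i))) by (eexists; eauto).
  destruct (unit_product_opp ns _ Hl Hu) as (v & Hv & Ev).
  pose proof (Hle _ Hu) as H1. pose proof (Hle v Hv) as H2. rewrite E in H1.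
  rewrite (frob_ext ns A A v (tscale (-1) (outer (map basis_vec i)))), frob_scale_r, E in H2;
    auto; [lra|].
  intros j Hj. unfold tscale. rewrite Ev by exact Hj. ring.
Qed.

Lemma frob_rank_one_le ns h Y i0 :
  In i0 (indices ns) -> rank_one ns Y -> frob ns Y h <= normF ns Y * specnorm ns h.
Proof.
  intros Hi0 [(xs & Hl & E) (i & Hi & Hne)].
  destruct (rank_one_normalize ns xs Hl) as (c & u & Hc & Hu & Ec).
  { exists i. split; [exact Hi|]. rewrite <- E; assumption. }
  assert (EY : forall i, In i (indices ns) -> Y i = tscale c u i).
  { intros j Hj. rewrite E by exact Hj. unfold tscale. auto. }
  rewrite (frob_ext ns Y (tscale c u) h h EY), (normF_ext ns Y (tscale c u) EY) by auto.
  rewrite frob_scale_l, normF_scale, (unit_product_normF ns u Hu), Rmult_1_r.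
  rewrite Rabs_pos_eq, frob_sym by lra. apply Rmult_le_compat_l; [lra|].
  apply (specnorm_max ns h i0 Hi0); exact Hu.
Qed.

(** The combination clause of [clarke] for an arbitrary set [S]: [clarke] is [V q] together with
    [conv] of the limits of gradients. *)
Definition conv (ns : list nat) (S : tensor -> Prop) (q : tensor) : Prop :=
  exists cgs : list (R * tensor),
    cgs <> [] /\
    Forall (fun cg => 0 <= fst cg /\ S (snd cg)) cgs /\
    lsum fst cgs = 1 /\
    forall i, In i (indices ns) -> q i = lsum (fun cg => fst cg * snd cg i) cgs.

Definition decomposition (ns : list nat) (A : tensor) (v : R) : Prop :=
  exists Ys : list tensor,
    Ys <> [] /\ Forall (rank_one ns) Ys /\
    (forall i, In i (indices ns) -> A i = lsum (fun Y => Y i) Ys) /\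
    v = lsum (normF ns) Ys.

(** Terms of weight zero are dropped, since rank-one tensors are nonzero; something remains because
    [A] is nonzero. The norm of each remaining term is its weight. *)
Lemma decomposition_of_combination ns A (l : list (R * tensor)) :
  (1 <= length ns)%nat -> tnonzero ns A ->
  Forall (fun cg => 0 <= fst cg /\ unit_product ns (snd cg)) l ->
  (forall i, In i (indices ns) -> A i = lsum (fun cg => fst cg * snd cg i) l) ->
  decomposition ns A (lsum fst l).
Proof.
  intros Hl (i0 & Hi0 & Hne) HF HA.
  enough (exists Ys, Forall (rank_one ns) Ys /\
    (forall i, lsum (fun cg => fst cg * snd cg i) l = lsum (fun Y => Y i) Ys) /\
    lsum fst l = lsum (normF ns) Ys) as (Ys & H1 & H2 & H3).
  { exists Ys. repeat split; auto.
    - intros ->. apply Hne. rewrite HA, H2 by exact Hi0. reflexivity.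
    - intros i Hi. rewrite HA by exact Hi. apply H2. }
  clear HA. induction HF as [|[c u] l [Hc Hu] _ IH].
  - exists []. split; [constructor|]. split; reflexivity.
  - destruct IH as (Ys & H1 & H2 & H3). cbn [fst snd] in *. destruct Hc as [Hc|<-].
    + exists (tscale c u :: Ys). split; [|split].
      * constructor; [|exact H1]. apply rank_one_scale; assumption.
      * intros i. rewrite !lsum_cons, H2. reflexivity.
      * rewrite !lsum_cons, H3, normF_scale, (unit_product_normF ns u Hu).
        rewrite Rabs_pos_eq by lra. cbn. ring.
    + exists Ys. split; [exact H1|]. split.
      * intros i. rewrite lsum_cons, H2. cbn. ring.
      * rewrite lsum_cons, H3. cbn. ring.
Qed.

(** Both sides are the Kronecker delta of [i] and [j]. *)
Lemma outer_basis_sym i j :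
  length i = length j -> outer (map basis_vec i) j = outer (map basis_vec j) i.
Proof.
  revert j. induction i as [|a i IH]; intros [|b j] H; try discriminate; [reflexivity|].
  cbn [map outer]. rewrite (IH j) by now injection H. f_equal.
  unfold basis_vec. do 2 destruct Nat.eq_dec; congruence.
Qed.

Lemma in_indices_length ns i : In i (indices ns) -> length i = length ns.
Proof.
  revert i. induction ns as [|n ns IH]; intros i Hi.
  - destruct Hi as [<-|[]]. reflexivity.
  - apply in_indices_cons in Hi as (k & j & -> & _ & Hj). cbn. f_equal. auto.
Qed.

(** This is the expansion in basis products; the sign of each entry is moved into the unit product,
    which leaves the weights [Rabs (A i)]. *)
Lemma decomposition_exists ns A :
  (1 <= length ns)%nat -> tnonzero ns A -> exists v, decomposition ns A v.
Proof.
  intros Hl Hnz.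
  destruct (choice (fun i u => In i (indices ns) -> unit_product ns u /\
    forall j, In j (indices ns) -> A i * outer (map basis_vec i) j = Rabs (A i) * u j))
    as [u Hu].
  (* Off the valid multi-indices nothing is required, and [A] is a dummy value. *)
  { intros i. destruct (classic (In i (indices ns))) as [Hi|]; [|exists A; tauto].
    destruct (basis_unit_product ns i A Hi) as [Hb _].
    assert (Hp : unit_product ns (outer (map basis_vec i))) by (eexists; eauto).
    destruct (Rcase_abs (A i)) as [Hn|Hp'].
    - destruct (unit_product_opp ns _ Hl Hp) as (v & Hv & E). exists v. split; [exact Hv|].
      intros j Hj. rewrite Rabs_left, E by assumption. ring.
    - eexists. split; [exact Hp|]. intros j Hj. rewrite Rabs_right by assumption. ring. }
  eexists. apply (decomposition_of_combination ns A
    (map (fun i => (Rabs (A i), u i)) (indices ns)) Hl Hnz).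
  - apply Forall_map, Forall_forall. intros i Hi. cbn. split; [apply Rabs_pos|].
    apply (Hu i Hi).
  - intros j Hj. rewrite lsum_map. cbn [fst snd].
    rewrite <- (proj2 (basis_unit_product ns j A Hj)). apply lsum_ext. intros i Hi.
    rewrite <- (proj2 (Hu i Hi) j Hj), outer_basis_sym; [reflexivity|].
    rewrite (in_indices_length ns i), (in_indices_length ns j); auto.
Qed.

(** Decompositions exist and their values are nonnegative, so the infimum behind [nucnorm] exists.
    It is obtained from [completeness] as minus the supremum of the negated values. *)
Lemma nucnorm_spec ns A :
  (1 <= length ns)%nat -> tnonzero ns A ->
  (forall v, decomposition ns A v -> nucnorm ns A <= v) /\
  (forall b, (forall v, decomposition ns A v -> b <= v) -> b <= nucnorm ns A).
Proof.
  intros Hl Hnz.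
  apply (epsilon_spec (inhabits 0) (fun m =>
    (forall v, decomposition ns A v -> m <= v) /\
    (forall b, (forall v, decomposition ns A v -> b <= v) -> b <= m))).
  destruct (completeness (fun w => decomposition ns A (- w))) as [m [Hm1 Hm2]].
  - exists 0. intros w (Ys & _ & _ & _ & E).
    pose proof (lsum_nonneg (normF ns) Ys ltac:(intros; apply normF_nonneg)). lra.
  - destruct (decomposition_exists ns A Hl Hnz) as [v Hv]. exists (- v).
    now rewrite Ropp_involutive.
  - exists (- m). split.
    + intros v Hv. rewrite <- (Ropp_involutive v). apply Ropp_le_contravar, Hm1.
      now rewrite Ropp_involutive.
    + intros b Hb. rewrite <- (Ropp_involutive b). apply Ropp_le_contravar, Hm2.
      intros w Hw. apply Hb in Hw. lra.
Qed.

(** Duality of the two norms: every term [Y] of a decomposition contributes at most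
    [normF ns Y * specnorm ns h], and the infimum is taken after division by [specnorm ns h]. *)
Lemma frob_le_nucnorm_specnorm ns A h :
  (1 <= length ns)%nat -> tnonzero ns A ->
  frob ns A h <= nucnorm ns A * specnorm ns h.
Proof.
  intros Hl Hnz. pose proof Hnz as (i0 & Hi0 & _).
  destruct (nucnorm_spec ns A Hl Hnz) as [_ Hglb].
  assert (H : forall v, decomposition ns A v -> frob ns A h <= v * specnorm ns h).
  { intros v (Ys & _ & HY & E & ->).
    rewrite (frob_ext ns A (fun i => lsum (fun Y => Y i) Ys) h h E) by auto.
    rewrite (frob_lsum_l ns (fun Y : tensor => Y)).
    rewrite Rmult_comm, <- lsum_scale. apply lsum_le. intros Y HYi.
    rewrite Rmult_comm. apply frob_rank_one_le with i0; [exact Hi0|].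
    rewrite Forall_forall in HY; auto. }
  destruct (specnorm_nonneg ns h i0 Hl Hi0) as [Hp|Hz].
  - apply Rmult_le_reg_r with (/ specnorm ns h); [now apply Rinv_0_lt_compat|].
    rewrite Rmult_assoc, Rinv_r, Rmult_1_r by lra.
    apply Hglb. intros v Hv. apply Rmult_le_reg_r with (specnorm ns h); [exact Hp|].
    rewrite Rmult_assoc, Rinv_l, Rmult_1_r by lra. auto.
  (* If the spectral norm of [h] is zero, a single decomposition already gives the bound 0. *)
  - destruct (decomposition_exists ns A Hl Hnz) as [v Hv].
    specialize (H v Hv). rewrite <- Hz in *. lra.
Qed.

(** * Convex hulls of compact sets *)

(** Gaussian elimination on the coordinates: a vector with nonzero coordinate [i0] serves as pivot
    and clears that coordinate from the others. *)
Lemma linear_dependence {I : Type} (idx : list I) (js : list nat) (v : nat -> I -> R) :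
  NoDup js -> (length idx < length js)%nat ->
  exists a : nat -> R, (exists j, In j js /\ a j <> 0) /\
    forall i, In i idx -> lsum (fun j => a j * v j i) js = 0.
Proof.
  revert js v. induction idx as [|i0 idx IH]; intros js v Hnd Hlen.
  - destruct js as [|j js]; [cbn in Hlen; lia|]. exists (fun _ => 1). split.
    + exists j. split; [apply in_eq|lra].
    + intros i [].
  - cbn in Hlen.
    destruct (classic (exists j0, In j0 js /\ v j0 i0 <> 0)) as [(j0 & Hj0 & Hv)|Hn].
    + destruct (in_split _ _ Hj0) as (l1 & l2 & E).
      assert (HP : Permutation js (j0 :: l1 ++ l2))
        by (rewrite E; symmetry; apply Permutation_middle).
      pose proof (Permutation_NoDup HP Hnd) as Hnd'. inversion Hnd' as [|? ? Hni Hnd'']; subst.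
      pose proof (Permutation_length HP) as HL. cbn [length] in HL.
      set (r := fun j => v j i0 / v j0 i0).
      destruct (IH (l1 ++ l2) (fun j i => v j i - r j * v j0 i)) as (a & (j & Hj & Ha) & Hs);
        [exact Hnd''|lia|].
      (* The coefficient of the pivot undoes the subtracted multiples [r j] of it. *)
      set (b := - lsum (fun j => a j * r j) (l1 ++ l2)).
      exists (fun j => if Nat.eq_dec j j0 then b else a j).
      assert (Hsum : forall i,
        lsum (fun j => (if Nat.eq_dec j j0 then b else a j) * v j i) (l1 ++ j0 :: l2) =
        lsum (fun j => a j * (v j i - r j * v j0 i)) (l1 ++ l2)).
      { intros i. rewrite (lsum_perm _ _ _ HP), lsum_cons.
        destruct Nat.eq_dec as [_|]; [|contradiction].
        rewrite (lsum_ext _ (fun j => a j * v j i) (l1 ++ l2)).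
        - unfold b.
          rewrite (lsum_ext (fun j => a j * (v j i - r j * v j0 i))
            (fun j => a j * v j i + (- v j0 i) * (a j * r j))) by (intros; ring).
          rewrite lsum_plus, lsum_scale. ring.
        - intros k Hk. destruct Nat.eq_dec as [->|]; [contradiction|reflexivity]. }
      split.
      * exists j. split.
        -- apply in_app_or in Hj as [Hj|Hj]; apply in_or_app; auto using in_cons.
        -- destruct Nat.eq_dec as [->|]; [contradiction|exact Ha].
      * intros i [<-|Hi]; rewrite Hsum; [|auto].
        rewrite <- (lsum_zero (l1 ++ l2)). apply lsum_ext. intros k _. unfold r. field. exact Hv.
    (* All vectors vanish at [i0], so one of them may be given coefficient 0 and the coordinate
       dropped. *)
    + destruct js as [|j js]; [cbn in Hlen; lia|]. inversion Hnd; subst.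
      destruct (IH js v) as (a & (k & Hk & Ha) & Hs); [assumption|cbn in Hlen; lia|].
      exists (fun m => if Nat.eq_dec m j then 0 else a m).
      assert (Hsum : forall i, lsum (fun m => (if Nat.eq_dec m j then 0 else a m) * v m i)
        (j :: js) = lsum (fun m => a m * v m i) js).
      { intros i. rewrite lsum_cons. destruct Nat.eq_dec as [_|]; [|contradiction].
        rewrite Rmult_0_l, Rplus_0_l. apply lsum_ext. intros m Hm.
        destruct Nat.eq_dec as [->|]; [contradiction|reflexivity]. }
      split.
      * exists k. split; [auto using in_cons|].
        destruct Nat.eq_dec as [->|]; [contradiction|exact Ha].
      * intros i [<-|Hi]; rewrite Hsum; [|auto].
        rewrite <- (lsum_zero js). apply lsum_ext. intros m Hm.
        enough (v m i0 = 0) as -> by ring.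
        apply NNPP; intros Hv. apply Hn. exists m. auto using in_cons.
Qed.

Lemma list_argmin {T : Type} (P : T -> Prop) (f : T -> R) l :
  (exists x, In x l /\ P x) ->
  exists x, In x l /\ P x /\ forall y, In y l -> P y -> f x <= f y.
Proof.
  induction l as [|a l IH]; intros (x & Hx & HP); [contradiction|].
  destruct (classic (exists x, In x l /\ P x)) as [Hl|Hl].
  - destruct (IH Hl) as (z & Hz & HPz & Hmin).
    destruct (classic (P a /\ f a <= f z)) as [[HPa Hle]|Hn].
    + exists a. split; [apply in_eq|]. split; [exact HPa|].
      intros y [<-|Hy] HPy; [lra|]. specialize (Hmin y Hy HPy). lra.
    + exists z. split; [auto using in_cons|]. split; [exact HPz|].
      intros y [<-|Hy] HPy; [|auto]. apply Rnot_lt_le; intros Hlt. apply Hn. split; [auto|lra].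
  - destruct Hx as [->|Hx]; [|exfalso; eauto].
    exists x. split; [apply in_eq|]. split; [exact HP|].
    intros y [<-|Hy] HPy; [lra|]. exfalso; eauto.
Qed.

(** With more than dimension plus one points, an affine dependence can be subtracted from the
    weights until one of them reaches zero. *)
Lemma caratheodory_step {I : Type} (idx : list I) (js : list nat) (c : nat -> R)
    (v : nat -> I -> R) :
  NoDup js -> (S (length idx) < length js)%nat -> (forall j, In j js -> 0 <= c j) ->
  exists c' : nat -> R,
    (forall j, In j js -> 0 <= c' j) /\ lsum c' js = lsum c js /\
    (forall i, In i idx -> lsum (fun j => c' j * v j i) js = lsum (fun j => c j * v j i) js) /\
    exists j, In j js /\ c' j = 0.
Proof.
  intros Hnd Hlen Hc.
  (* The extra coordinate [None], constantly 1, forces the coefficients of the dependence to sum to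
     zero. *)
  destruct (linear_dependence (None :: map Some idx) js
    (fun j o => match o with Some i => v j i | None => 1 end)) as (a & (j0 & Hj0 & Ha) & Hs).
  { exact Hnd. } { cbn. rewrite length_map. exact Hlen. }
  (* After a change of sign if necessary, some coefficient is positive. *)
  assert (Hpos : exists a : nat -> R, (exists j, In j js /\ 0 < a j) /\ lsum a js = 0 /\
    forall i, In i idx -> lsum (fun j => a j * v j i) js = 0).
  { pose proof (Hs None (in_eq _ _)) as H1. cbn beta iota in H1.
    rewrite (lsum_ext _ a) in H1 by (intros; ring).
    assert (H2 : forall i, In i idx -> lsum (fun j => a j * v j i) js = 0).
    { intros i Hi. apply (Hs (Some i)). apply in_cons, in_map, Hi. }
    destruct (Rtotal_order (a j0) 0) as [Hlt|[|Hgt]]; [|contradiction|].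
    - exists (fun j => -1 * a j). split; [|split].
      + exists j0. split; [exact Hj0|lra].
      + rewrite lsum_scale, H1. ring.
      + intros i Hi. rewrite (lsum_ext _ (fun j => -1 * (a j * v j i))) by (intros; ring).
        rewrite lsum_scale, H2 by exact Hi. ring.
    - exists a. eauto. }
  clear a Ha Hs j0 Hj0. destruct Hpos as (a & Hpos & Hs1 & Hs).
  destruct (list_argmin (fun j => 0 < a j) (fun j => c j / a j) js Hpos)
    as (j0 & Hj0 & Ha & Hmin).
  (* The smallest ratio over positive coefficients is the largest step that keeps all weights
     nonnegative; it annihilates the weight of [j0]. *)
  set (t := c j0 / a j0).
  assert (Ht : 0 <= t) by (apply Rmult_le_pos; [auto|left; now apply Rinv_0_lt_compat]).
  exists (fun j => c j + (- t) * a j). split; [|split; [|split]].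
  - intros j Hj. destruct (Rlt_le_dec 0 (a j)) as [Hp|Hn].
    + specialize (Hmin j Hj Hp). cbn beta in Hmin. fold t in Hmin.
      assert (t * a j <= c j); [|lra].
      replace (c j) with (c j / a j * a j) by (field; lra).
      apply Rmult_le_compat_r; lra.
    + specialize (Hc j Hj). nra.
  - rewrite lsum_plus, lsum_scale, Hs1. ring.
  - intros i Hi.
    rewrite (lsum_ext _ (fun j => c j * v j i + (- t) * (a j * v j i))) by (intros; ring).
    rewrite lsum_plus, lsum_scale, Hs by exact Hi. ring.
  - exists j0. split; [exact Hj0|]. unfold t. field. lra.
Qed.

Lemma lsum_nth (F : nat -> R) l :
  lsum (fun k => F (nth k l 0%nat)) (seq 0 (length l)) = lsum F l.
Proof.
  induction l as [|a l IH]; [reflexivity|].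
  cbn [length seq]. rewrite <- seq_shift, !lsum_cons, lsum_map, <- IH. reflexivity.
Qed.

Definition seq_compact (ns : list nat) (G : tensor -> Prop) : Prop :=
  forall s : nat -> tensor, (forall k, G (s k)) ->
  exists phi g, G g /\ (forall n : nat, (n <= phi n)%nat) /\
    forall i, In i (indices ns) -> Un_cv (fun k => s (phi k) i) (g i).

(** For a fixed number [M] of points, the weights (bounded by 1) and the points of [G] range over a
    compact set, on which the squared distance to [q] is continuous. *)
Lemma nearest_combination ns (G : tensor -> Prop) q M :
  seq_compact ns G -> (exists g, G g) -> (0 < M)%nat ->
  let D := fun p : (nat -> R) * (nat -> tensor) =>
    (forall j, In j (seq 0 M) -> 0 <= fst p j /\ G (snd p j)) /\
    lsum (fst p) (seq 0 M) = 1 in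
  let dist := fun p : (nat -> R) * (nat -> tensor) =>
    let e := tsub (fun i => lsum (fun j => fst p j * snd p j i) (seq 0 M)) q in
    frob ns e e in
  exists p, D p /\ forall p', D p' -> dist p <= dist p'.
Proof.
  intros Hcomp [g0 Hg0] HM D dist.
  destruct (extreme_value D (fun p => - dist p)) as (p & Hp & Hmin).
  (* All the weight sits on position 0, which exists because [M] is positive. *)
  - exists (basis_vec 0, fun _ => g0). split.
    + intros j _. cbn. split; [unfold basis_vec; destruct Nat.eq_dec; lra|exact Hg0].
    + cbn. rewrite <- (lsum_basis_vec 0 (fun _ => 1) M HM). apply lsum_ext; intros; ring.
  - intros s Hs.
    destruct (bounded_subsequence_list (seq 0 M) (fun k => fst (s k)) 1)
      as (phi & c & Hphi & Hc).
    { intros k j Hj. destruct (Hs k) as [Hk <-].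
      rewrite Rabs_pos_eq by (apply Hk, Hj). apply lsum_ge_term; [|exact Hj].
      intros; apply Hk; assumption. }
    destruct (simultaneous_subsequence g0 G G
      (fun u x => forall i, In i (indices ns) -> Un_cv (fun k => u k i) (x i))
      (seq 0 M) (fun k => snd (s (phi k)))) as (psi & g & Hpsi & Hg).
    { intros u chi x Hchi H i Hi. exact (cv_sub _ chi _ Hchi (H i Hi)). }
    { exact Hcomp. }
    { intros k j Hj. apply (Hs (phi k)), Hj. }
    assert (Hc' : forall j, In j (seq 0 M) -> Un_cv (fun k => fst (s (phi (psi k))) j) (c j)).
    { intros j Hj. apply (cv_sub (fun k => fst (s (phi k)) j) psi); auto. }
    exists (fun k => phi (psi k)), (c, g). split; [|split].
    + split; cbn [fst snd].
      * intros j Hj. split; [|apply Hg, Hj].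
        refine (Rle_cv_lim _ (cv_const 0) (Hc' j Hj)).
        intros k. apply (Hs (phi (psi k))), Hj.
      * refine (UL_sequence _ _ _ (cv_lsum (fun k => fst (s (phi (psi k)))) c (seq 0 M) Hc') _).
        apply (cv_ext (fun _ => 1)); [|apply cv_const].
        intros k. symmetry. apply (Hs (phi (psi k))).
    + intros n. specialize (Hpsi n). specialize (Hphi (psi n)). lia.
    + apply CV_opp. unfold dist.
      assert (Hcv : forall i, In i (indices ns) -> Un_cv (fun k =>
        tsub (fun i => lsum (fun j => fst (s (phi (psi k))) j * snd (s (phi (psi k))) j i)
          (seq 0 M)) q i)
        (tsub (fun i => lsum (fun j => fst (c, g) j * snd (c, g) j i) (seq 0 M)) q i)).
      { intros i Hi. apply CV_minus; [|apply cv_const].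
        apply (cv_lsum (fun k j => fst (s (phi (psi k))) j * snd (s (phi (psi k))) j i)
          (fun j => c j * g j i)).
        intros j Hj. apply CV_mult; [apply Hc', Hj|]. apply (proj2 (Hg j Hj)), Hi. }
      apply cv_frob; exact Hcv.
  - exists p. split; [exact Hp|]. intros p' Hp'. specialize (Hmin p' Hp'). lra.
Qed.

(* In dimension [N], if the nearest combination [m] of [N + 1] points were not [q], moving it
   towards a [g] with [<q, q - m> <= <g, q - m>] would bring it closer to [q], and
   Caratheodory's theorem rewrites the moved point with [N + 1] points again. *)
Lemma conv_of_support ns (G : tensor -> Prop) q :
  seq_compact ns G -> (forall h, exists g, G g /\ frob ns q h <= frob ns g h) -> conv ns G q.
Proof.
  intros Hcomp Hsupp. set (M := S (length (indices ns))).
  destruct (nearest_combination ns G q M Hcomp) as ([c g] & [HD Hsum] & Hmin).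
  { destruct (Hsupp q) as (g & Hg & _). eauto. } { unfold M; lia. }
  cbn [fst snd] in *.
  set (m := fun i => lsum (fun j => c j * g j i) (seq 0 M)) in *.
  destruct (frob_pos ns (tsub m q)) as [Hpos|Hz].
  2:{ exists (map (fun j => (c j, g j)) (seq 0 M)). split; [|split; [|split]].
      - discriminate.
      - apply Forall_map, Forall_forall. exact HD.
      - rewrite lsum_map. exact Hsum.
      - intros i Hi. rewrite lsum_map. cbn [fst snd].
        assert (E : normF ns (tsub m q) = 0) by (unfold normF; rewrite <- Hz; apply sqrt_0).
        pose proof (normF_zero ns _ i E Hi) as H. unfold tsub, m in H. lra. }
  exfalso. destruct (Hsupp (tsub q m)) as (gs & Hgs & Hle).
  set (a := frob ns (tsub m q) (tsub m q)) in *.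
  set (B := frob ns (tsub gs m) (tsub gs m)).
  assert (HB : 0 <= B) by apply frob_pos.
  (* The squared distance after a move by [eps] towards [gs] is at most a - 2 eps a + eps^2 B; this
     choice gives eps B <= a, hence at most a - eps a < a. *)
  set (eps := a / (a + B)).
  assert (He : 0 < eps <= 1).
  { unfold eps. split; [apply Rdiv_lt_0_compat; lra|].
    apply Rmult_le_reg_r with (a + B); [lra|]. unfold Rdiv.
    rewrite Rmult_assoc, Rinv_l by lra. lra. }
  assert (HeB : eps * (a + B) = a) by (unfold eps; field; lra).
  (* The new point [gs] takes position [M], with weight [eps]. *)
  set (c1 := fun j => if Nat.eq_dec j M then eps else (1 - eps) * c j).
  set (g1 := fun j => if Nat.eq_dec j M then gs else g j).
  assert (Hadd : forall F : nat -> R,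
    lsum (fun j => c1 j * F j) (seq 0 (S M)) =
    (1 - eps) * lsum (fun j => c j * F j) (seq 0 M) + eps * F M).
  { intros F. rewrite seq_S, lsum_app, lsum_cons, lsum_nil, <- lsum_scale, Nat.add_0_l.
    unfold c1. destruct (Nat.eq_dec M M) as [_|]; [|contradiction].
    rewrite Rplus_0_r. f_equal. apply lsum_ext. intros j Hj. apply in_seq in Hj.
    destruct Nat.eq_dec; [lia|ring]. }
  destruct (caratheodory_step (indices ns) (seq 0 (S M)) c1 g1)
    as (c2 & Hc2 & Hs2 & Hv2 & j1 & Hj1 & Hz1).
  { apply seq_NoDup. } { rewrite length_seq. unfold M. lia. }
  { intros j Hj. apply in_seq in Hj. unfold c1. destruct Nat.eq_dec; [lra|].
    apply Rmult_le_pos; [lra|]. apply HD, in_seq. lia. }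
  (* Removing the position [j1] of weight zero leaves [M] positions, renumbered below by [nth]. *)
  destruct (in_split _ _ Hj1) as (l1 & l2 & E). set (js := l1 ++ l2).
  assert (HP : Permutation (seq 0 (S M)) (j1 :: js))
    by (rewrite E; symmetry; apply Permutation_middle).
  assert (Hjs : length js = M).
  { apply Permutation_length in HP. rewrite length_seq in HP. cbn in HP. lia. }
  assert (Hre : forall F : nat -> R,
    lsum (fun k => c2 (nth k js 0%nat) * F (nth k js 0%nat)) (seq 0 M) =
    lsum (fun j => c2 j * F j) (seq 0 (S M))).
  { intros F. rewrite (lsum_perm _ _ _ HP), lsum_cons, Hz1, <- Hjs.
    rewrite (lsum_nth (fun j => c2 j * F j) js). ring. }
  assert (Hin : forall k, In k (seq 0 M) -> In (nth k js 0%nat) (seq 0 (S M))).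
  { intros k Hk. apply (Permutation_in _ (Permutation_sym HP)), in_cons, nth_In.
    apply in_seq in Hk. lia. }
  specialize (Hmin (fun k => c2 (nth k js 0%nat), fun k => g1 (nth k js 0%nat))).
  cbn [fst snd] in Hmin.
  assert (Hlt : frob ns (tsub (tadd m (tscale eps (tsub gs m))) q)
    (tsub (tadd m (tscale eps (tsub gs m))) q) < a).
  { replace (frob ns (tsub (tadd m (tscale eps (tsub gs m))) q)
      (tsub (tadd m (tscale eps (tsub gs m))) q))
      with (a + 2 * eps * (frob ns (tsub gs m) (tsub m q)) + eps * eps * B).
    - assert (H : frob ns (tsub gs m) (tsub m q) <= - a).
      { unfold a. rewrite !frob_sub_l, !frob_sub_r in *.
        rewrite (frob_sym ns m q) in *. lra. }
      assert (eps * eps * B <= eps * a) by nra. nra.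
    - unfold a, B. rewrite !frob_sub_l, !frob_add_l, !frob_sub_r, !frob_add_r,
        !frob_scale_l, !frob_scale_r, !frob_sub_l, !frob_sub_r.
      rewrite (frob_sym ns m q), (frob_sym ns m gs), (frob_sym ns gs q). ring. }
  apply (Rlt_not_le _ _ Hlt). unfold a at 1. etransitivity; [apply Hmin; clear Hmin|].
  - split.
    + intros k Hk. specialize (Hin k Hk). split; [apply Hc2, Hin|].
      unfold g1. destruct Nat.eq_dec as [|Hne]; [exact Hgs|].
      apply in_seq in Hin. apply HD, in_seq. lia.
    + transitivity (lsum (fun j => c2 j * 1) (seq 0 (S M))).
      { rewrite <- Hre. apply lsum_ext; intros; ring. }
      rewrite (lsum_ext _ c2), Hs2 by (intros; ring).
      rewrite (lsum_ext _ (fun j => c1 j * 1)), Hadd by (intros; ring).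
      rewrite (lsum_ext _ c), Hsum by (intros; ring). ring.
  - right.
    assert (Em : forall i, In i (indices ns) ->
      tsub (fun i => lsum (fun j => c2 (nth j js 0%nat) * g1 (nth j js 0%nat) i) (seq 0 M)) q i
      = tsub (tadd m (tscale eps (tsub gs m))) q i).
    { intros i Hi. unfold tsub at 1. rewrite (Hre (fun j => g1 j i)), Hv2, Hadd by exact Hi.
      rewrite (lsum_ext (fun j => c j * g1 j i) (fun j => c j * g j i)).
      - fold (m i). unfold g1. destruct Nat.eq_dec; [|contradiction].
        unfold tsub, tadd, tscale. ring.
      - intros j Hj. apply in_seq in Hj. unfold g1. destruct Nat.eq_dec; [lia|reflexivity]. }
    apply frob_ext; exact Em.
Qed.

(** * Limits of gradients of the spectral norm *)

(** One interface for both spaces of the theorem. The field [proj_frob] says that [A - P A] is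
    orthogonal to [V]. *)
Record orthogonal_projection (ns : list nat) (V : tensor -> Prop) (P : tensor -> tensor) :
    Prop := {
  subspace_add : forall A B, V A -> V B -> V (tadd A B);
  subspace_sub : forall A B, V A -> V B -> V (tsub A B);
  subspace_scale : forall c A, V A -> V (tscale c A);
  proj_in : forall A, V (P A);
  proj_frob : forall A h, V h -> frob ns (P A) h = frob ns A h }.

(** By orthogonality |Pa - Pb|^2 = <a - b, Pa - Pb>, and Cauchy-Schwarz applies. *)
Lemma proj_nonexpansive ns V P a b :
  orthogonal_projection ns V P -> normF ns (tsub (P a) (P b)) <= normF ns (tsub a b).
Proof.
  intros HP. pose proof (normF_nonneg ns (tsub a b)) as H1.
  destruct (normF_nonneg ns (tsub (P a) (P b))) as [Hp|<-]; [|exact H1].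
  apply Rmult_le_reg_r with (normF ns (tsub (P a) (P b))); [exact Hp|].
  rewrite normF_sq. etransitivity; [|apply cauchy_schwarz]. right.
  assert (HV : V (tsub (P a) (P b))) by (apply (subspace_sub _ _ _ HP); apply (proj_in _ _ _ HP)).
  rewrite frob_sub_l, !(proj_frob _ _ _ HP), <- frob_sub_l by exact HV. reflexivity.
Qed.

Lemma proj_cv ns V P (v : nat -> tensor) u :
  orthogonal_projection ns V P ->
  (forall i, In i (indices ns) -> Un_cv (fun k => v k i) (u i)) ->
  forall i, In i (indices ns) -> Un_cv (fun k => P (v k) i) (P u i).
Proof.
  intros HP H i Hi. apply (cv_coord ns (fun k => P (v k))); [|exact Hi].
  apply (cv_squeeze0 _ (fun k => normF ns (tsub (v k) u))); [|apply cv_normF, H].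
  intros k. split; [apply normF_nonneg|]. exact (proj_nonexpansive ns V P _ _ HP).
Qed.

Lemma eq_on_subspace ns V P g u :
  orthogonal_projection ns V P -> V g ->
  (forall h, V h -> frob ns g h = frob ns u h) ->
  forall i, In i (indices ns) -> g i = P u i.
Proof.
  intros HP Vg H i Hi.
  assert (HV : V (tsub g (P u))).
  { apply (subspace_sub _ _ _ HP); [exact Vg|apply (proj_in _ _ _ HP)]. }
  assert (E : normF ns (tsub g (P u)) = 0).
  { unfold normF. rewrite frob_sub_l, (proj_frob _ _ _ HP), H, Rminus_diag by exact HV.
    apply sqrt_0. }
  pose proof (normF_zero ns _ i E Hi) as H0. unfold tsub in H0. lra.
Qed.

(** The linear function <., u> lies below the spectral norm and touches it at [p], so <u, h> <= <g,
    h>; replacing [h] by [-h] gives equality. *)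
Lemma gradient_is_maximizer ns V P p g u :
  orthogonal_projection ns V P -> has_grad ns V (specnorm ns) p g ->
  unit_product ns u -> specnorm ns p = frob ns p u ->
  forall h, V h -> frob ns g h = frob ns u h.
Proof.
  intros HP [Vg Hg] Hu Ep.
  assert (Hle : forall h, V h -> frob ns u h <= frob ns g h).
  { intros h Vh. destruct (normF_nonneg ns h) as [Hn|Hn].
    2:{ rewrite !(frob_sym ns _ h), !frob_zero_l by auto. lra. }
    apply le_epsilon. intros e He.
    destruct (Hg (e / normF ns h)) as (delta & Hd & Hdelta).
    { now apply Rdiv_lt_0_compat. }
    (* The increment [t h] then has norm [delta / 2], and the differentiability error is at most
       [t * e]. *)
    set (t := delta / 2 / normF ns h).
    assert (Ht : 0 < t) by (apply Rdiv_lt_0_compat; lra).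
    assert (Etn : normF ns (tscale t h) = delta / 2).
    { rewrite normF_scale, Rabs_pos_eq by lra. unfold t. field. lra. }
    specialize (Hdelta (tscale t h) (subspace_scale _ _ _ HP t h Vh)).
    rewrite Etn in Hdelta. specialize (Hdelta ltac:(lra)).
    assert (E : e / normF ns h * (delta / 2) = t * e) by (unfold t; field; lra).
    rewrite E in Hdelta. apply (Rle_trans _ _ _ (Rle_abs _)) in Hdelta.
    destruct (indices ns) as [|i0 l] eqn:Ei.
    { unfold normF, frob in Hn. rewrite Ei, lsum_nil, sqrt_0 in Hn. lra. }
    assert (Hi0 : In i0 (indices ns)) by (rewrite Ei; apply in_eq).
    destruct (specnorm_max ns (tadd p (tscale t h)) i0 Hi0) as [_ Hmax].
    specialize (Hmax u Hu). rewrite frob_add_l, frob_scale_l in Hmax.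
    rewrite frob_scale_r in Hdelta. rewrite (frob_sym ns u h).
    apply Rmult_le_reg_l with t; [exact Ht|]. lra. }
  intros h Vh. apply Rle_antisym; [|auto].
  specialize (Hle (tscale (-1) h) (subspace_scale _ _ _ HP _ h Vh)).
  rewrite !frob_scale_r in Hle. lra.
Qed.

(** Maximisers at the approximating points accumulate at some [u] by compactness; maximality and the
    identity with the gradients pass to the limit. *)
Lemma limit_grad_is_maximizer ns V P p g i0 :
  orthogonal_projection ns V P -> In i0 (indices ns) ->
  limit_grad ns V (specnorm ns) p g ->
  exists u, unit_product ns u /\ specnorm ns p = frob ns p u /\
    forall h, V h -> frob ns g h = frob ns u h.
Proof.
  intros HP Hi0 (Vg & ps & gs & Vps & Hgrad & Hps & Hgs).
  destruct (choice (fun k u => unit_product ns u /\ specnorm ns (ps k) = frob ns (ps k) u))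
    as [us Hus].
  { intros k. apply (specnorm_max ns (ps k) i0 Hi0). }
  destruct (unit_product_compact ns us) as (phi & u & Hu & Hphi & Hcv).
  { intros; apply Hus. }
  assert (Hp : forall i, In i (indices ns) -> Un_cv (fun k => ps (phi k) i) (p i)).
  { intros i Hi. apply (cv_sub (fun k => ps k i) phi _ Hphi), (cv_coord ns ps p i Hps Hi). }
  assert (Hg : forall i, In i (indices ns) -> Un_cv (fun k => gs (phi k) i) (g i)).
  { intros i Hi. apply (cv_sub (fun k => gs k i) phi _ Hphi), (cv_coord ns gs g i Hgs Hi). }
  exists u. split; [exact Hu|]. split.
  - apply (specnorm_eq_max ns p u Hu) with i0; [|exact Hi0]. intros v Hv.
    refine (Rle_cv_lim _ (cv_frob ns (fun k => ps (phi k)) (fun _ => v) p v Hp _)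
      (cv_frob ns (fun k => ps (phi k)) (fun k => us (phi k)) p u Hp Hcv)).
    + intros k. destruct (Hus (phi k)) as [_ <-].
      apply (specnorm_max ns (ps (phi k)) i0 Hi0); exact Hv.
    + intros; apply cv_const.
  - intros h Vh.
    refine (UL_sequence _ _ _ (cv_frob ns (fun k => gs (phi k)) (fun _ => h) g h Hg _) _).
    + intros; apply cv_const.
    + apply (cv_ext (fun k => frob ns (us (phi k)) h)).
      * intros k. symmetry. destruct (Hus (phi k)).
        apply (gradient_is_maximizer ns V P (ps (phi k)) (gs (phi k))); auto.
      * apply cv_frob; [exact Hcv|]. intros; apply cv_const.
Qed.

(** Let [v] maximise at [p + h] and d = |Pv - Pu|. Growth gives s d^2 <= <h, Pv - Pu> <= |h| d, so d
    <= |h| / s, while the linearisation error lies between 0 and |h| d. *)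
Lemma has_grad_of_growth ns V P p u s i0 :
  orthogonal_projection ns V P -> In i0 (indices ns) -> 0 < s -> unit_product ns u ->
  (forall v, unit_product ns v ->
     frob ns p v <= frob ns p u - s * frob ns (tsub (P v) (P u)) (tsub (P v) (P u))) ->
  specnorm ns p = frob ns p u /\ has_grad ns V (specnorm ns) p (P u).
Proof.
  intros HP Hi0 Hs Hu Hgr.
  assert (Ep : specnorm ns p = frob ns p u).
  { apply (specnorm_eq_max ns p u Hu) with i0; [|exact Hi0]. intros v Hv.
    specialize (Hgr v Hv). pose proof (frob_pos ns (tsub (P v) (P u))). nra. }
  split; [exact Ep|]. split; [apply (proj_in _ _ _ HP)|].
  (* For |h| < eps s the bound d <= |h| / s yields d <= eps. *)
  intros eps He. exists (eps * s). split; [nra|]. intros h Vh [Hn0 Hn].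
  destruct (specnorm_max ns (tadd p h) i0 Hi0) as [(v & Hv & Ev) Hmax].
  specialize (Hmax u Hu). specialize (Hgr v Hv). rewrite Ep.
  rewrite Ev in *. rewrite !frob_add_l in *.
  pose proof (cauchy_schwarz ns h (tsub (P v) (P u))) as CS.
  rewrite frob_sub_r, !(frob_sym ns h (P _)), !(proj_frob _ _ _ HP) in CS by exact Vh.
  rewrite (proj_frob _ _ _ HP) by exact Vh.
  rewrite (frob_sym ns v h), (frob_sym ns u h) in *.
  rewrite <- normF_sq in Hgr.
  pose proof (normF_nonneg ns (tsub (P v) (P u))) as Hd.
  set (d := normF ns (tsub (P v) (P u))) in *. set (n := normF ns h) in *.
  assert (Hde : d <= eps).
  { apply Rnot_lt_le; intros Hlt. assert (s * (d * d) <= n * d) by lra.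
    assert (n * d < eps * s * d) by (apply Rmult_lt_compat_r; lra).
    assert (s * d * eps < s * d * d) by (apply Rmult_lt_compat_l; [apply Rmult_lt_0_compat|]; lra).
    lra. }
  assert (n * d <= eps * n) by nra.
  apply Rabs_le. split; nra.
Qed.

(* Maximising [<b, v> + s |P v|^2] over unit products selects a [u] such that the maximum of
   [<b + 2 s P u, .>] grows quadratically away from [u]. *)
Lemma differentiable_nearby ns V P b s i0 :
  orthogonal_projection ns V P -> In i0 (indices ns) -> 0 < s -> V b ->
  exists u, unit_product ns u /\
    let p := tadd b (tscale (2 * s) (P u)) in
    V p /\ specnorm ns p = frob ns p u /\ has_grad ns V (specnorm ns) p (P u).
Proof.
  intros HP Hi0 Hs Vb.
  destruct (extreme_value (unit_product ns)
    (fun v => frob ns b v + s * frob ns (P v) (P v))) as (u & Hu & Hmax).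
  - eexists. eexists. split; [|reflexivity]. apply (basis_unit_product ns i0 b Hi0).
  - intros us Hus. destruct (unit_product_compact ns us Hus) as (phi & u & Hu & Hphi & Hcv).
    exists phi, u. split; [exact Hu|]. split; [exact Hphi|].
    pose proof (proj_cv ns V P (fun k => us (phi k)) u HP Hcv) as HPcv.
    apply CV_plus.
    + apply (cv_frob ns (fun _ => b) (fun k => us (phi k))); [|exact Hcv].
      intros; apply cv_const.
    + apply CV_mult; [apply cv_const|].
      apply (cv_frob ns (fun k => P (us (phi k))) (fun k => P (us (phi k)))); exact HPcv.
  - exists u. split; [exact Hu|]. cbn zeta. split.
    { apply (subspace_add _ _ _ HP); [exact Vb|].
      apply (subspace_scale _ _ _ HP), (proj_in _ _ _ HP). }
    apply (has_grad_of_growth ns V P _ u s i0 HP Hi0 Hs Hu). intros v Hv.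
    (* Expanding s |Pv - Pu|^2 and using <Pu, v> = <Pu, Pv> turns the growth inequality into the
       maximality of [u]. *)
    specialize (Hmax v Hv). cbn beta in Hmax.
    rewrite !frob_add_l, !frob_scale_l, frob_sub_l, !frob_sub_r.
    rewrite (frob_sym ns (P u) v), (frob_sym ns (P u) u).
    rewrite <- (proj_frob _ _ _ HP v (P u)), <- (proj_frob _ _ _ HP u (P u))
      by apply (proj_in _ _ _ HP).
    rewrite (frob_sym ns (P u) (P v)). lra.
Qed.

(** Differentiability points are taken near [p] in the direction [h]; the bound <q, .> <= f, with
    equality at [p], compares [q] with the gradients there. *)
Lemma limit_grad_support ns V P p q h i0 :
  orthogonal_projection ns V P -> In i0 (indices ns) -> V p -> V h ->
  (forall h', V h' -> frob ns q h' <= specnorm ns h') -> frob ns q p = specnorm ns p ->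
  exists g, limit_grad ns V (specnorm ns) p g /\ frob ns q h <= frob ns g h.
Proof.
  intros HP Hi0 Vp Vh Hq Eqp. set (t := fun k => / (INR k + 1)).
  assert (Ht : forall k, 0 < t k) by apply inv_S_pos.
  (* The perturbation is of order t^2, so it still vanishes after division by [t]. *)
  set (pt := fun k u => tadd (tadd p (tscale (t k) h)) (tscale (2 * (t k * t k)) (P u))).
  destruct (choice (fun k u => unit_product ns u /\ V (pt k u) /\
    specnorm ns (pt k u) = frob ns (pt k u) u /\ has_grad ns V (specnorm ns) (pt k u) (P u)))
    as [us Hus].
  { intros k. apply (differentiable_nearby ns V P (tadd p (tscale (t k) h)) (t k * t k) i0 HP Hi0).
    - specialize (Ht k). nra.
    - apply (subspace_add _ _ _ HP); [exact Vp|]. apply (subspace_scale _ _ _ HP), Vh. }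
  destruct (unit_product_compact ns us) as (phi & u & Hu & Hphi & Hcv).
  { intros; apply Hus. }
  pose proof (proj_cv ns V P (fun k => us (phi k)) u HP Hcv) as HPcv.
  assert (Htcv : Un_cv (fun k => t (phi k)) 0) by exact (cv_sub t phi 0 Hphi cv_inv_S).
  exists (P u). split.
  - split; [apply (proj_in _ _ _ HP)|].
    exists (fun k => pt (phi k) (us (phi k))), (fun k => P (us (phi k))). split; [|split; [|split]].
    + intros k. apply Hus.
    + intros k. apply Hus.
    + apply cv_normF. intros i Hi.
      replace (p i) with ((p i + 0 * h i) + (2 * (0 * 0)) * P u i) by ring.
      apply CV_plus; [apply CV_plus|]; [apply cv_const| |].
      * apply CV_mult; [exact Htcv|apply cv_const].
      * apply CV_mult; [|auto].
        apply CV_mult; [apply cv_const|]. apply CV_mult; exact Htcv.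
    + apply cv_normF. exact HPcv.
  (* From <q, pt> <= f pt = <pt, u> subtract <p, u> <= f p = <q, p> in the form <q, p> >= <p, u>,
     then divide by [t k]. *)
  - assert (Hk : forall k, frob ns q h + 2 * t k * frob ns q (P (us k)) <=
      frob ns h (P (us k)) + 2 * t k * frob ns (P (us k)) (P (us k))).
    { intros k. destruct (Hus k) as (Huk & Vpk & Ek & _). specialize (Ht k).
      pose proof (Hq _ Vpk) as H1. rewrite Ek in H1.
      destruct (specnorm_max ns p i0 Hi0) as [_ Hmax]. specialize (Hmax _ Huk).
      rewrite <- Eqp in Hmax. unfold pt in H1.
      rewrite !frob_add_r, !frob_add_l, !frob_scale_r, !frob_scale_l in H1.
      rewrite (frob_sym ns h (P (us k))), !(proj_frob _ _ _ HP)
        by (exact Vh || apply (proj_in _ _ _ HP)).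
      rewrite (frob_sym ns (P (us k)) (us k)), (frob_sym ns h (us k)) in H1.
      apply Rmult_le_reg_l with (t k); [exact Ht|]. lra. }
    replace (frob ns q h) with (frob ns q h + 2 * 0 * frob ns q (P u)) by ring.
    replace (frob ns (P u) h) with (frob ns h (P u) + 2 * 0 * frob ns (P u) (P u))
      by (rewrite (frob_sym ns h); ring).
    refine (Rle_cv_lim (fun k => Hk (phi k)) _ _).
    + apply CV_plus; [apply cv_const|].
      apply CV_mult; [apply CV_mult; [apply cv_const|exact Htcv]|].
      apply (cv_frob ns (fun _ => q) (fun k => P (us (phi k)))); [|exact HPcv].
      intros; apply cv_const.
    + apply CV_plus.
      * apply (cv_frob ns (fun _ => h) (fun k => P (us (phi k)))); [|exact HPcv].
        intros; apply cv_const.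
      * apply CV_mult; [apply CV_mult; [apply cv_const|exact Htcv]|].
        apply (cv_frob ns (fun k => P (us (phi k))) (fun k => P (us (phi k)))); exact HPcv.
Qed.

(** Limits of gradients are projected unit products, so a subsequence converges to some [P u]; a
    diagonal choice shows that [P u] is again a limit of gradients at [p]. *)
Lemma limit_grad_compact ns V P p i0 :
  orthogonal_projection ns V P -> In i0 (indices ns) ->
  seq_compact ns (limit_grad ns V (specnorm ns) p).
Proof.
  intros HP Hi0 s Hs.
  destruct (choice (fun k u => unit_product ns u /\
    forall i, In i (indices ns) -> s k i = P u i)) as [us Hus].
  { intros k. destruct (limit_grad_is_maximizer ns V P p (s k) i0 HP Hi0 (Hs k))
      as (u & Hu & _ & E). exists u. split; [exact Hu|].
    apply (eq_on_subspace ns V P (s k) u HP); [apply Hs|exact E]. }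
  destruct (unit_product_compact ns us) as (phi & u & Hu & Hphi & Hcv).
  { intros; apply Hus. }
  pose proof (proj_cv ns V P (fun k => us (phi k)) u HP Hcv) as HPcv.
  assert (Hscv : forall i, In i (indices ns) -> Un_cv (fun k => s (phi k) i) (P u i)).
  { intros i Hi. apply (cv_ext (fun k => P (us (phi k)) i)); [|auto].
    intros k. symmetry. apply (Hus (phi k)), Hi. }
  exists phi, (P u). split; [|split; [exact Hphi|exact Hscv]].
  split; [apply (proj_in _ _ _ HP)|].
  (* The diagonal choice: a differentiability point close to [p] whose gradient is equally close to
     [s (phi k)]. *)
  destruct (choice (fun k pg => V (fst pg) /\ has_grad ns V (specnorm ns) (fst pg) (snd pg) /\
    normF ns (tsub (fst pg) p) < / (INR k + 1) /\
    normF ns (tsub (snd pg) (s (phi k))) < / (INR k + 1))) as [pgs Hpgs].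
  { intros k. destruct (Hs (phi k)) as (_ & ps & gs & Vps & Hgrad & Hps & Hgs).
    destruct (Hps _ (inv_S_pos k)) as [N1 HN1]. destruct (Hgs _ (inv_S_pos k)) as [N2 HN2].
    exists (ps (N1 + N2)%nat, gs (N1 + N2)%nat). cbn [fst snd].
    specialize (HN1 (N1 + N2)%nat ltac:(lia)). specialize (HN2 (N1 + N2)%nat ltac:(lia)).
    unfold Rdist in *. rewrite Rminus_0_r, Rabs_pos_eq in * by apply normF_nonneg. auto. }
  exists (fun k => fst (pgs k)), (fun k => snd (pgs k)).
  split; [intros; apply Hpgs|]. split; [intros; apply Hpgs|]. split.
  - apply (cv_squeeze0 _ (fun k => / (INR k + 1))); [|apply cv_inv_S].
    intros k. split; [apply normF_nonneg|]. left. apply Hpgs.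
  - apply cv_normF. intros i Hi.
    assert (H0 : Un_cv (fun k => snd (pgs k) i - s (phi k) i) 0).
    { apply (cv_coord ns (fun k => tsub (snd (pgs k)) (s (phi k))) (fun _ => 0)); [|exact Hi].
      apply (cv_squeeze0 _ (fun k => / (INR k + 1))); [|apply cv_inv_S].
      intros k. split; [apply normF_nonneg|]. left.
      rewrite (normF_ext ns _ (tsub (snd (pgs k)) (s (phi k)))); [apply Hpgs|].
      intros; unfold tsub; ring. }
    apply (cv_ext (fun k => s (phi k) i + (snd (pgs k) i - s (phi k) i))); [intros; ring|].
    rewrite <- (Rplus_0_r (P u i)). apply CV_plus; auto.
Qed.

(** * The norm criterion on a subspace with an orthogonal projection *)

Lemma combination_flatten ns (S T : tensor -> Prop) (l : list (R * tensor)) :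
  (forall g, S g -> conv ns T g) ->
  Forall (fun cg => 0 <= fst cg /\ S (snd cg)) l ->
  exists l', Forall (fun cg => 0 <= fst cg /\ T (snd cg)) l' /\ lsum fst l' = lsum fst l /\
    forall i, In i (indices ns) ->
      lsum (fun cg => fst cg * snd cg i) l = lsum (fun cg => fst cg * snd cg i) l'.
Proof.
  intros HS. induction 1 as [|[c g] l [Hc Hg] _ IH]; cbn [fst snd] in *.
  - exists []. auto.
  - destruct IH as (l' & HF & Hsum & Hval).
    destruct (HS g Hg) as (cgs & _ & HF' & Hsum' & Hval').
    (* The weights of nested combinations multiply. *)
    exists (map (fun cg => (c * fst cg, snd cg)) cgs ++ l'). split; [|split].
    + apply Forall_app. split; [|exact HF]. apply Forall_map.
      apply (Forall_impl _ (P := fun cg => 0 <= fst cg /\ T (snd cg))); [|exact HF'].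
      intros [c' u] [Hc' Hu]. cbn in *. split; [nra|exact Hu].
    + rewrite lsum_app, lsum_map, lsum_cons, Hsum. cbn [fst].
      rewrite lsum_scale, Hsum', Rmult_1_r. reflexivity.
    + intros i Hi. rewrite lsum_app, lsum_map, lsum_cons, Hval, Hval' by exact Hi.
      cbn [fst snd]. rewrite <- lsum_scale. f_equal. apply lsum_ext; intros [? ?] _; cbn; ring.
Qed.

(** The hypothesis on [P] keeps projected unit products in the convex hull of unit products, which
    bounds the nuclear norm in the ambient tensor space. *)
Lemma critical_iff_norms ns V P A :
  orthogonal_projection ns V P ->
  (forall u, unit_product ns u -> conv ns (unit_product ns) (P u)) ->
  (1 <= length ns)%nat -> V A -> tnonzero ns A ->
  (critical ns V A <-> specnorm ns A * nucnorm ns A = normF ns A ^ 2).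
Proof.
  intros HP Hconv Hl VA Hnz. pose proof Hnz as (i0 & Hi0 & _).
  pose proof (normF_pos ns A Hnz) as HN. pose proof (specnorm_pos ns A Hl Hnz) as Hf.
  pose proof (frob_le_nucnorm_specnorm ns A A Hl Hnz) as Hge.
  rewrite <- normF_sq in Hge.
  set (N := normF ns A) in *. set (f := specnorm ns A) in *. set (nu := nucnorm ns A) in *.
  set (p := tscale (/ N) A).
  assert (Vp : V p) by (apply (subspace_scale _ _ _ HP), VA).
  assert (HiN : 0 < / N) by (now apply Rinv_0_lt_compat).
  assert (Efp : specnorm ns p = / N * f) by (apply specnorm_scale with i0; [exact Hi0|lra]).
  assert (Eqp : forall lam, frob ns (tscale lam A) p = lam * N).
  { intros lam. unfold p. rewrite frob_scale_l, frob_scale_r, <- normF_sq. fold N. field. lra. }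
  split.
  - intros (_ & lam & _ & cgs & _ & HF & Hsum & Hval). fold N in HF. fold p in HF.
    (* Every limit of gradients at [p] pairs with [p] to [specnorm ns p]; the convex combination
       [lam A] does so too, which determines [lam]. *)
    assert (Elam : lam * N = / N * f).
    { rewrite <- Eqp.
      rewrite (frob_ext ns _ (fun i => lsum (fun cg : R * tensor => fst cg * snd cg i) cgs)
        p p Hval) by auto.
      rewrite (frob_lsum_l ns (fun (cg : R * tensor) i => fst cg * snd cg i)).
      rewrite (lsum_ext _ (fun cg => specnorm ns p * fst cg)), lsum_scale, Hsum; [lra|].
      intros [c g] Hcg. rewrite Forall_forall in HF. destruct (HF _ Hcg) as [_ Hg].
      cbn [fst snd] in *.
      destruct (limit_grad_is_maximizer ns V P p g i0 HP Hi0 Hg) as (u & _ & -> & E).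
      change (frob ns (tscale c g) p = frob ns p u * c).
      rewrite frob_scale_l, E, (frob_sym ns p u) by exact Vp. ring. }
    assert (Hlam : 0 < lam).
    { apply Rmult_lt_reg_r with N; [exact HN|]. rewrite Elam, Rmult_0_l. nra. }
    destruct (fun H => combination_flatten ns _ (unit_product ns) cgs H HF)
      as (l & HFl & Hsuml & Hvall).
    { intros g Hg. destruct (limit_grad_is_maximizer ns V P p g i0 HP Hi0 Hg) as (u & Hu & _ & E).
      destruct (Hconv u Hu) as (l & H1 & H2 & H3 & H4). exists l. repeat split; auto.
      intros i Hi. rewrite <- H4 by exact Hi.
      apply (eq_on_subspace ns V P g u HP); auto. apply Hg. }
    (* Dividing the combination for [lam A] by [lam] decomposes [A] with total norm [/ lam]. *)
    assert (Hnu : nu <= / lam).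
    { apply (nucnorm_spec ns A Hl Hnz).
      replace (/ lam) with (lsum fst (map (fun cg => (/ lam * fst cg, snd cg)) l)).
      - apply decomposition_of_combination; [exact Hl|exact Hnz| |].
        + apply Forall_map.
          apply (Forall_impl _ (P := fun cg => 0 <= fst cg /\ unit_product ns (snd cg)));
            [|exact HFl].
          intros [c u] [Hc Hu]. cbn in *. split; [|exact Hu].
          apply Rmult_le_pos; [left; now apply Rinv_0_lt_compat|exact Hc].
        + intros i Hi. rewrite lsum_map. cbn [fst snd].
          rewrite (lsum_ext _ (fun cg => / lam * (fst cg * snd cg i)))
            by (intros [? ?] _; cbn; ring).
          rewrite lsum_scale, <- Hvall, <- Hval by exact Hi. unfold tscale. field. lra.
      - rewrite lsum_map. cbn [fst]. rewrite lsum_scale, Hsuml, Hsum. ring. }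
    assert (Ef : f = lam * N * N) by (rewrite Elam; field; lra).
    assert (lam * nu <= 1).
    { rewrite <- (Rinv_r lam) by lra. apply Rmult_le_compat_l; lra. }
    assert (f * nu <= N * N).
    { rewrite Ef. replace (lam * N * N * nu) with (N * N * (lam * nu)) by ring.
      rewrite <- (Rmult_1_r (N * N)) at 2. apply Rmult_le_compat_l; nra. }
    nra.
  (* This [lam] is forced by pairing with [p]; the assumed equality says exactly that lam nu = 1. *)
  - intros E. split; [exact Hnz|]. fold N. fold p. set (lam := f / (N * N)).
    assert (Hlam : 0 < lam) by (apply Rdiv_lt_0_compat; nra).
    assert (Elnu : lam * nu = 1).
    { unfold lam. replace (f / (N * N) * nu) with (f * nu / (N * N)) by (field; lra).
      rewrite E. field. lra. }
    assert (Vq : V (tscale lam A)) by (apply (subspace_scale _ _ _ HP), VA).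
    exists lam. split; [exact Vq|]. apply conv_of_support.
    + apply limit_grad_compact with P i0; assumption.
    (* The support inequality is proved in the direction [P h] and carries over to [h], since both
       [lam A] and [g] lie in [V]. *)
    + intros h.
      destruct (limit_grad_support ns V P p (tscale lam A) (P h) i0 HP Hi0 Vp
        (proj_in _ _ _ HP h)) as (g & Hg & Hle).
      * intros h' _. rewrite frob_scale_l.
        pose proof (frob_le_nucnorm_specnorm ns A h' Hl Hnz) as H. fold nu in H.
        replace (specnorm ns h') with (lam * nu * specnorm ns h') by (rewrite Elnu; ring).
        rewrite Rmult_assoc. apply Rmult_le_compat_l; lra.
      * rewrite Eqp, Efp. unfold lam. field. lra.
      * exists g. split; [exact Hg|]. pose proof (proj1 Hg) as Vg.
        rewrite !(frob_sym ns _ (P h)), !(proj_frob _ _ _ HP) in Hle by assumption.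
        rewrite !(frob_sym ns _ h). exact Hle.
Qed.

Lemma full_space_projection ns : orthogonal_projection ns full_space (fun A => A).
Proof. split; intros; exact I || reflexivity. Qed.

Lemma conv_in ns (S : tensor -> Prop) u : S u -> conv ns S u.
Proof.
  intros H. exists [(1, u)]. split; [discriminate|]. split; [|split].
  - repeat constructor; [cbn; lra|exact H].
  - rewrite lsum_cons, lsum_nil. cbn. ring.
  - intros. rewrite lsum_cons, lsum_nil. cbn. ring.
Qed.

(** * Symmetrization *)

(* [insert_sum x l A] sums [A] over the lists obtained by inserting [x] into [l], and
   [perm_sum l A] sums [A] over the rearrangements of [l], counted by positions. *)
Fixpoint insert_sum (x : nat) (l : list nat) (A : tensor) : R :=
  match l with
  | [] => A [x]
  | y :: l' => A (x :: y :: l') + insert_sum x l' (fun m => A (y :: m))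
  end.

Fixpoint perm_sum (l : list nat) (A : tensor) : R :=
  match l with
  | [] => A []
  | x :: l' => perm_sum l' (fun m => insert_sum x m A)
  end.

Lemma insert_sum_ext x l A B :
  (forall m, Permutation (x :: l) m -> A m = B m) -> insert_sum x l A = insert_sum x l B.
Proof.
  revert A B. induction l as [|y l IH]; intros A B H; cbn.
  - apply H. reflexivity.
  - f_equal; [apply H; reflexivity|]. apply IH. intros m Hm. apply H.
    rewrite perm_swap. apply perm_skip, Hm.
Qed.

Lemma perm_sum_ext l A B :
  (forall m, Permutation l m -> A m = B m) -> perm_sum l A = perm_sum l B.
Proof.
  revert A B. induction l as [|x l IH]; intros A B H; cbn.
  - apply H. reflexivity.
  - apply IH. intros m Hm. apply insert_sum_ext. intros m' Hm'. apply H.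
    rewrite Hm. exact Hm'.
Qed.

Lemma insert_sum_plus x l A B :
  insert_sum x l (fun m => A m + B m) = insert_sum x l A + insert_sum x l B.
Proof.
  revert A B. induction l as [|y l IH]; intros A B; cbn; [reflexivity|].
  rewrite (IH (fun m => A (y :: m)) (fun m => B (y :: m))). ring.
Qed.

Lemma perm_sum_plus l A B :
  perm_sum l (fun m => A m + B m) = perm_sum l A + perm_sum l B.
Proof.
  revert A B. induction l as [|x l IH]; intros A B; cbn; [reflexivity|].
  rewrite <- IH. apply perm_sum_ext. intros; apply insert_sum_plus.
Qed.

Lemma insert_sum_scale x l c A : insert_sum x l (fun m => c * A m) = c * insert_sum x l A.
Proof.
  revert A. induction l as [|y l IH]; intros A; cbn; [reflexivity|].
  rewrite (IH (fun m => A (y :: m))). ring.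
Qed.

Lemma perm_sum_scale l c A : perm_sum l (fun m => c * A m) = c * perm_sum l A.
Proof.
  revert A. induction l as [|x l IH]; intros A; cbn; [reflexivity|].
  rewrite <- IH. apply perm_sum_ext. intros; apply insert_sum_scale.
Qed.

Lemma perm_sum_lsum {T : Type} l (F : T -> tensor) (ts : list T) :
  perm_sum l (fun m => lsum (fun t => F t m) ts) = lsum (fun t => perm_sum l (F t)) ts.
Proof.
  induction ts as [|t ts IH].
  - rewrite lsum_nil, <- (Rmult_0_l (perm_sum l (fun _ => 0))), <- perm_sum_scale.
    apply perm_sum_ext. intros. rewrite lsum_nil. ring.
  - rewrite lsum_cons, <- IH, <- perm_sum_plus. reflexivity.
Qed.

(** Both sides range over all ways of placing [x] and [y] into [l]. It is the adjacent swap behind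
    the invariance of [perm_sum]. *)
Lemma insert_sum_comm x y l A :
  insert_sum x l (fun m => insert_sum y m A) = insert_sum y l (fun m => insert_sum x m A).
Proof.
  revert A. induction l as [|z l IH]; intros A; cbn; [ring|].
  rewrite (insert_sum_plus x l (fun m => A (y :: z :: m))
    (fun m => insert_sum y m (fun m => A (z :: m)))).
  rewrite (insert_sum_plus y l (fun m => A (x :: z :: m))
    (fun m => insert_sum x m (fun m => A (z :: m)))).
  rewrite (IH (fun m => A (z :: m))). ring.
Qed.

Lemma perm_sum_invariant l l' A : Permutation l l' -> perm_sum l A = perm_sum l' A.
Proof.
  intros H. revert A. induction H; intros A; cbn; auto.
  - apply perm_sum_ext. intros m _. apply insert_sum_comm.
  - etransitivity; eauto.
Qed.

(** Each multi-index of length [S d] arises once for each of the [S d] positions of the inserted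
    entry. *)
Lemma insert_sum_total n d A :
  lsum (fun x => lsum (fun l => insert_sum x l A) (indices (repeat n d))) (seq 0 n) =
  INR (S d) * lsum A (indices (repeat n (S d))).
Proof.
  revert A. induction d as [|d IH]; intros A.
  - cbn [repeat]. rewrite lsum_indices_cons. cbn [INR]. rewrite Rmult_1_l. reflexivity.
  - change (repeat n (S (S d))) with (n :: repeat n (S d)). rewrite S_INR, lsum_indices_cons.
    (* The first sum has [x] inserted in front; the second keeps the head [y] and inserts further
       on, where induction applies. *)
    transitivity (lsum (fun x => lsum (fun y => lsum (fun l => A (x :: y :: l))
      (indices (repeat n d))) (seq 0 n)) (seq 0 n) +
      lsum (fun y => lsum (fun x => lsum (fun l => insert_sum x l (fun m => A (y :: m)))
      (indices (repeat n d))) (seq 0 n)) (seq 0 n)).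
    + rewrite (lsum_swap (fun y x => lsum (fun l => insert_sum x l (fun m => A (y :: m)))
        (indices (repeat n d)))), <- lsum_plus.
      apply lsum_ext. intros x _. change (repeat n (S d)) with (n :: repeat n d).
      rewrite lsum_indices_cons, <- lsum_plus. apply lsum_ext. intros y _.
      rewrite <- lsum_plus. reflexivity.
    + rewrite Rmult_plus_distr_r, Rmult_1_l, Rplus_comm. f_equal.
      * rewrite <- lsum_scale. apply lsum_ext. intros y _. apply (IH (fun m => A (y :: m))).
      * apply lsum_ext. intros x _. change (repeat n (S d)) with (n :: repeat n d).
        rewrite lsum_indices_cons. reflexivity.
Qed.

(** Each of the [fact d] rearrangements of positions permutes the multi-indices, because all
    dimensions are equal. *)
Lemma perm_sum_total n d A :
  lsum (fun l => perm_sum l A) (indices (repeat n d)) =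
  INR (fact d) * lsum A (indices (repeat n d)).
Proof.
  revert A. induction d as [|d IH]; intros A.
  - cbn. ring.
  - rewrite fact_simpl, mult_INR, (Rmult_comm (INR (S d))), Rmult_assoc, <- insert_sum_total.
    change (repeat n (S d)) with (n :: repeat n d).
    rewrite lsum_indices_cons, <- lsum_scale. apply lsum_ext. intros x _.
    apply (IH (fun m => insert_sum x m A)).
Qed.

Lemma in_indices_repeat n d i :
  In i (indices (repeat n d)) <-> length i = d /\ Forall (fun k => (k < n)%nat) i.
Proof.
  revert i. induction d as [|d IH]; intros i.
  - cbn. split.
    + intros [<-|[]]. auto.
    + intros [H _]. destruct i; [auto|discriminate].
  - change (repeat n (S d)) with (n :: repeat n d). rewrite in_indices_cons. split.
    + intros (k & j & -> & Hk & Hj). apply IH in Hj as [<- Hj]. split; [reflexivity|].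
      constructor; assumption.
    + intros [H HF]. destruct HF as [|k j Hk Hj]; [discriminate|]. exists k, j.
      split; [reflexivity|]. split; [exact Hk|]. apply IH. split; [now injection H|exact Hj].
Qed.

(** The average over the symmetric group, which is the orthogonal projection onto the symmetric
    tensors. *)
Definition symmetrize (d : nat) (A : tensor) : tensor :=
  fun i => / INR (fact d) * perm_sum i A.

Lemma sym_space_projection n d :
  orthogonal_projection (repeat n d) (sym_space (repeat n d)) (symmetrize d).
Proof.
  split.
  - intros A B HA HB i j Hi Hij. unfold tadd. rewrite (HA i j), (HB i j); auto.
  - intros A B HA HB i j Hi Hij. unfold tsub. rewrite (HA i j), (HB i j); auto.
  - intros c A HA i j Hi Hij. unfold tscale. rewrite (HA i j); auto.
  - intros A i j _ Hij. unfold symmetrize. f_equal. apply perm_sum_invariant, Hij.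
  - intros A h Hh. unfold frob.
    rewrite (lsum_ext _ (fun i => / INR (fact d) * perm_sum i (fun j => A j * h j))).
    + rewrite lsum_scale, perm_sum_total, <- Rmult_assoc, Rinv_l, Rmult_1_l;
        [reflexivity|apply INR_fact_neq_0].
    + intros i Hi. unfold symmetrize.
      (* A symmetric [h] is constant on the rearrangements of [i], so [h i] can be moved inside the
         sum. *)
      rewrite (perm_sum_ext i (fun j => A j * h j) (fun j => h i * A j)).
      * rewrite perm_sum_scale. ring.
      * intros j Hij. rewrite (Hh i j Hi Hij). ring.
Qed.

(** Each entry is paired with the list of the others in their order, once per position. *)
Fixpoint selections {T : Type} (xs : list T) : list (T * list T) :=
  match xs with
  | [] => []
  | x :: xs' => (x, xs') :: map (fun zr => (fst zr, x :: snd zr)) (selections xs')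
  end.

Lemma selections_permutation {T : Type} (xs : list T) z r :
  In (z, r) (selections xs) -> Permutation xs (z :: r).
Proof.
  revert z r. induction xs as [|x xs IH]; intros z r; cbn; [contradiction|].
  intros [H|H].
  - injection H as -> ->. reflexivity.
  - apply in_map_iff in H as ([w s] & H & Hin). cbn in H. injection H as -> <-.
    rewrite (IH z s Hin). apply perm_swap.
Qed.

Lemma selections_length {T : Type} (xs : list T) : length (selections xs) = length xs.
Proof. induction xs; cbn; [reflexivity|]. rewrite length_map. congruence. Qed.

(** When [x] is inserted at some position, the factor there is evaluated at [x] and the remaining
    factors meet [l] in order. *)
Lemma insert_sum_outer x l xs :
  length xs = S (length l) ->
  insert_sum x l (outer xs) = lsum (fun zr => fst zr x * outer (snd zr) l) (selections xs).
Proof.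
  revert xs. induction l as [|y l IH]; intros [|z xs] H; try discriminate.
  - destruct xs; [|discriminate]. cbn. ring.
  - cbn [selections]. rewrite lsum_cons, lsum_map. cbn [insert_sum outer fst snd]. f_equal.
    rewrite (insert_sum_scale x l (z y) (outer xs)), (IH xs) by now injection H.
    rewrite <- lsum_scale. apply lsum_ext. intros [w r] _. cbn. ring.
Qed.

(* The permanent expansion: permuting the arguments of a product of vectors amounts to
   permuting the vectors. *)
Lemma perm_sum_outer d xs :
  length xs = d ->
  exists yss, length yss = fact d /\ Forall (Permutation xs) yss /\
    forall l, length l = d -> perm_sum l (outer xs) = lsum (fun ys => outer ys l) yss.
Proof.
  revert xs. induction d as [|d IH]; intros xs H.
  - exists [[]]. destruct xs; [|discriminate]. split; [reflexivity|]. split; [repeat constructor|].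
    intros l Hl. destruct l; [|discriminate]. cbn. ring.
  - destruct (choice (fun r yss => length r = d ->
      length yss = fact d /\ Forall (Permutation r) yss /\
      forall l, length l = d -> perm_sum l (outer r) = lsum (fun ys => outer ys l) yss))
      as [Y HY].
    { intros r. destruct (classic (length r = d)) as [Hr|]; [|exists []; tauto].
      destruct (IH r Hr) as (yss & Hyss). eauto. }
    assert (Hsel : forall z r, In (z, r) (selections xs) -> length r = d).
    { intros z r Hin. apply selections_permutation, Permutation_length in Hin.
      cbn in Hin. lia. }
    (* A rearrangement of [xs] is a selected first vector followed by a rearrangement of the
       rest. *)
    exists (flat_map (fun zr => map (cons (fst zr)) (Y (snd zr))) (selections xs)).
    split; [|split].
    + rewrite (flat_map_constant_length (c := fact d)).
      * rewrite selections_length, H. reflexivity.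
      * intros [z r] Hin. rewrite length_map. apply (HY r (Hsel z r Hin)).
    + apply Forall_flat_map, Forall_forall. intros [z r] Hin. apply Forall_map.
      destruct (HY r (Hsel z r Hin)) as (_ & HP & _). revert HP. apply Forall_impl.
      intros ys Hys. rewrite (selections_permutation xs z r Hin). apply perm_skip, Hys.
    + intros [|x l] Hl; [discriminate|]. injection Hl as Hl. cbn [perm_sum].
      rewrite (perm_sum_ext l _
        (fun m => lsum (fun zr => fst zr x * outer (snd zr) m) (selections xs))).
      * rewrite (perm_sum_lsum l (fun zr m => fst zr x * outer (snd zr) m)), lsum_flat_map.
        apply lsum_ext. intros [z r] Hin. cbn [fst snd].
        rewrite (perm_sum_scale l (z x) (outer r)), lsum_map.
        rewrite (proj2 (proj2 (HY r (Hsel z r Hin))) l Hl), <- lsum_scale. reflexivity.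
      * intros m Hm. apply insert_sum_outer. apply Permutation_length in Hm. lia.
Qed.

Lemma unit_vec_repeat n d xs :
  Forall2 unit_vec (repeat n d) xs <-> length xs = d /\ Forall (unit_vec n) xs.
Proof.
  split.
  - intros H. split; [rewrite <- (Forall2_length H); apply repeat_length|].
    revert xs H. induction d as [|d IH]; intros xs H; inversion H; subst; constructor; auto.
  - intros [<- H]. induction H; cbn; constructor; auto.
Qed.

(** The symmetrised product is the average of the [fact d] products with permuted factors; these are
    unit products because all dimensions are equal. *)
Lemma symmetrize_conv n d u :
  unit_product (repeat n d) u ->
  conv (repeat n d) (unit_product (repeat n d)) (symmetrize d u).
Proof.
  intros (xs & Hxs & ->). apply unit_vec_repeat in Hxs as [Hl HF].
  destruct (perm_sum_outer d xs Hl) as (yss & Hlen & HP & Hsum).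
  pose proof (INR_fact_neq_0 d) as Hd.
  exists (map (fun ys => (/ INR (fact d), outer ys)) yss). split; [|split; [|split]].
  - intros E. apply map_eq_nil in E. subst yss. apply Hd. rewrite <- Hlen. reflexivity.
  - apply Forall_map. apply (Forall_impl _ (P := Permutation xs)); [|exact HP].
    intros ys Hys. cbn [fst snd]. split; [left; apply Rinv_0_lt_compat, INR_fact_lt_0|].
    exists ys. split; [|reflexivity]. apply unit_vec_repeat. split.
    + rewrite <- Hl. symmetry. apply Permutation_length, Hys.
    + apply (Permutation_Forall Hys), HF.
  - rewrite lsum_map. cbn [fst].
    transitivity (/ INR (fact d) * INR (length yss)); [|rewrite Hlen; field; exact Hd].
    clear. induction yss as [|ys yss IH]; [cbn; ring|].
    rewrite lsum_cons, IH. cbn [length]. rewrite S_INR. ring.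
  - intros i Hi. rewrite lsum_map. cbn [fst snd]. unfold symmetrize.
    rewrite Hsum, <- lsum_scale by (apply (in_indices_repeat n d i), Hi). reflexivity.
Qed.

Theorem theorem1p11 :
  (forall (ns : list nat) (A : tensor),
      (1 <= length ns)%nat -> tnonzero ns A ->
      (critical ns full_space A <->
       specnorm ns A * nucnorm ns A = normF ns A ^ 2))
  /\
  (forall (d n : nat) (A : tensor),
      (1 <= d)%nat -> sym_space (repeat n d) A -> tnonzero (repeat n d) A ->
      (critical (repeat n d) (sym_space (repeat n d)) A <->
       specnorm (repeat n d) A * nucnorm (repeat n d) A =
       normF (repeat n d) A ^ 2)).
Proof.
  split.
  - intros ns A Hl Hnz. apply critical_iff_norms with (fun A => A); auto.
    + apply full_space_projection.
    + intros u Hu. apply conv_in, Hu.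
    + exact I.
  - intros d n A Hd HA Hnz. apply critical_iff_norms with (symmetrize d); auto.
    + apply sym_space_projection.
    + apply symmetrize_conv.
    + rewrite repeat_length. exact Hd.
Qed.
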